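(* Let $\Phi\colon\mathbb{R}^n\to\mathbb{R}$ be a continuous function and let $\boldsymbol{v}_0\in\mathbb{R}^n$. Let $K\colon\mathbb{R}^n\to[0,+\infty)$ be a piecewise affine $1$-homogeneous convex function. Assume that there exist linearly independent vectors $\boldsymbol{u}_1,\dots,\boldsymbol{u}_n\in\mathbb{R}^n$ and positive scalars $a_i,b_i>0$ for each $i\in\{1,\dots,n\}$ such that $$\{\boldsymbol{x}\in\mathbb{R}^n\colon K(\boldsymbol{x})\le1\}=\operatorname{co}\left(\bigcup_{j=1}^n\left\{\frac1{a_j}\boldsymbol{u}_j,-\frac1{b_j}\boldsymbol{u}_j\right\}\right),$$ where $\operatorname{co}E$ denotes the convex hull of a set $E$. Let $P$ be the matrix whose columns are $\boldsymbol{u}_1,\dots,\boldsymbol{u}_n$, and let $M:=PP^T$. Define $V\colon\mathbb{R}^n\times[0,+\infty)\to\mathbb{R}$ by $$V(\boldsymbol{x},t):=\inf_{\boldsymbol{w}\in\prod_{i=1}^n[y_i-a_it,\,y_i+b_it]}\left\{\sum_{i=1}^nV(y_i,t;w_i,a_i,b_i)+\Phi\left((P^T)^{-1}\boldsymbol{w}+\boldsymbol{v}_0\right)\right\},$$ where $\boldsymbol{y}=(y_1,\dots,y_n):=P^T\boldsymbol{x}-P^T\boldsymbol{v}_0$. Then $V$ is the unique viscosity solution in the solution set $C(\mathbb{R}^n\times[0,+\infty))$ to the Hamilton-Jacobi PDE $$\begin{cases}\dfrac{\partial V}{\partial t}(\boldsymbol{x},t)+K(\nabla_{\boldsymbol{x}}V(\boldsymbol{x},t))-\dfrac12\|\boldsymbol{x}-\boldsymbol{v}_0\|_M^2=0&\boldsymbol{x}\in\mathbb{R}^n,\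 t\in(0,+\infty),\\ V(\boldsymbol{x},0)=\Phi(\boldsymbol{x})&\boldsymbol{x}\in\mathbb{R}^n.\end{cases}$$
   Context: The norm is $\|\boldsymbol{z}\|_M:=\sqrt{\langle\boldsymbol{z},M\boldsymbol{z}\rangle}$. $C(\mathbb{R}^n\times[0,+\infty))$ is the set of continuous real-valued functions. One-dimensional function $V(x,t;u,a,b)$. For $a,b>0$ define subsets $\Omega_i=\Omega_i(a,b)$ of $\mathbb{R}\times[0,+\infty)\times[0,+\infty)$ by $\Omega_1:=\{(x,t,u)\colon 0\le t<\frac ub,\ u-bt\le x\le u+at\}\cup\{(x,t,u)\colon t\ge\frac ub,\ at-\frac{au}{b}\le x\le u+at\}$, $\Omega_2:=\{(x,t,u)\colon t\ge\frac ub,\ 0\le x<at-\frac{au}{b}\}$, $\Omega_3:=\{(x,t,u)\colon t\ge\frac ub,\ u-bt\le x<0\}$. For $x\in\mathbb{R}$, $t\ge0$ and $u\ge0$, define $V(x,t;u,a,b)\in\mathbb{R}\cup\{+\infty\}$ by $V(x,t;u,a,b)=\frac{u^3}{6b}+\frac{x^3}{6a}-\left(\frac1{6a}+\frac1{6b}\right)\left(\frac{au+bx-abt}{a+b}\right)^3$ if $(x,t,u)\in\Omega_1$; $\ =\frac{u^3}{6b}+\frac{x^3}{6a}$ if $(x,t,u)\in\Omega_2$; $\ =\frac{u^3}{6b}-\frac{x^3}{6b}$ if $(x,t,u)\in\Omega_3$; $\ =+\infty$ otherwise. For $u<0$, define $V(x,t;u,a,b):=V(-x,t;-u,b,a)$.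 This function is finite exactly when $u-bt\le x\le u+at$. *)

(* Defs.v *)
(* Vectors of R^n are columns of type 'cV[R]_n. *)
From HB Require Import structures.
From mathcomp Require Import all_boot all_order all_algebra.
From mathcomp Require Import all_classical all_reals all_analysis.
Set Implicit Arguments.
Unset Strict Implicit.
Unset Printing Implicit Defensive.
Import Order.TTheory GRing.Theory Num.Theory.
Import numFieldNormedType.Exports.
Local Open Scope classical_set_scope.
Local Open Scope ring_scope.

Section Vectors.
Context {R : realType} {n : nat}.
Implicit Types (x z : 'cV[R]_n) (f : 'cV[R]_n -> R).

Definition inner x z : R := \sum_(i < n) x i 0 * z i 0.

Definition mnorm (M : 'M[R]_n) z : R := Num.sqrt (inner z (M *m z)).

Definition conv_hull (E : set 'cV[R]_n) : set 'cV[R]_n :=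
  smallest (@convex_set R 'cV[R]_n) E.

Definition polyhedral (C : set 'cV[R]_n) : Prop :=
  exists (m : nat) (A : 'M[R]_(m, n)) (c : 'cV[R]_m),
    C = [set x | forall k : 'I_m, (A *m x) k 0 <= c k 0].

Definition piecewise_affine f : Prop :=
  exists (N : nat) (C : 'I_N -> set 'cV[R]_n)
         (p : 'I_N -> 'cV[R]_n) (d : 'I_N -> R),
    [/\ forall k, polyhedral (C k),
        \bigcup_k C k = setT &
        forall k x, C k x -> f x = inner (p k) x + d k].

Definition homogeneous1 f : Prop :=
  forall (c : R) x, 0 < c -> f (c *: x) = c * f x.

End Vectors.

Section OneDimensional.
Context {R : realType}.
Implicit Types x t u a b : R.

(* A triple (x, t, u) is ((x, t), u) : R * R * R. *)
Definition Omega0 : set (R * R * R) := [set q | 0 <= q.1.2 /\ 0 <= q.2].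

Definition Omega1 a b : set (R * R * R) :=
  Omega0 `&`
  ([set q | let: (x, t, u) := q in
      (0 <= t < u / b) /\ (u - b * t <= x <= u + a * t)] `|`
   [set q | let: (x, t, u) := q in
      u / b <= t /\ (a * t - a * u / b <= x <= u + a * t)]).

Definition Omega2 a b : set (R * R * R) :=
  Omega0 `&`
  [set q | let: (x, t, u) := q in
     u / b <= t /\ (0 <= x < a * t - a * u / b)].

Definition Omega3 a b : set (R * R * R) :=
  Omega0 `&`
  [set q | let: (x, t, u) := q in
     u / b <= t /\ (u - b * t <= x < 0)].

(* The values of V(x,t;u,a,b) for 0 <= u. *)
Definition V1_nneg x t u a b : \bar R :=
  if (x, t, u) \in Omega1 a b then
    (u ^+ 3 / (6 * b) + x ^+ 3 / (6 * a)
     - (1 / (6 * a) + 1 / (6 * b))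
       * ((a * u + b * x - a * b * t) / (a + b)) ^+ 3)%:E
  else if (x, t, u) \in Omega2 a b then
    (u ^+ 3 / (6 * b) + x ^+ 3 / (6 * a))%:E
  else if (x, t, u) \in Omega3 a b then
    (u ^+ 3 / (6 * b) - x ^+ 3 / (6 * b))%:E
  else +oo%E.

Definition V1 x t u a b : \bar R :=
  if 0 <= u then V1_nneg x t u a b else V1_nneg (- x) t (- u) b a.

End OneDimensional.

Section LaxOleinik.
Context {R : realType} {n : nat}.

(* The infimum is taken in \bar R; whether it is finite is part of what has
   to be proved about [value]. *)
Definition valueE (P : 'M[R]_n) (a b : 'I_n -> R) (v0 : 'cV[R]_n)
    (Phi : 'cV[R]_n -> R) (x : 'cV[R]_n) (t : R) : \bar R :=
  let y := P^T *m x - P^T *m v0 in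
  ereal_inf
    [set (\sum_(i < n) V1 (y i 0%R) t (w i 0%R) (a i) (b i)
          + (Phi (invmx P^T *m w + v0)%R)%:E)%E
    | w in [set w : 'cV[R]_n |
              forall i, y i 0 - a i * t <= w i 0 <= y i 0 + b i * t]].

Definition value P a b v0 Phi (p : 'cV[R]_n * R) : R :=
  fine (valueE P a b v0 Phi p.1 p.2).

End LaxOleinik.

Section Viscosity.
Context {R : realType} {n : nat}.
Implicit Types (W phi : 'cV[R]_n * R -> R) (p : 'cV[R]_n * R).

Definition dt phi p : R := 'D_((0 : 'cV[R]_n), (1 : R)) phi p.

Definition grad_x phi p : 'cV[R]_n :=
  \col_(i < n) 'D_((delta_mx i 0 : 'cV[R]_n), (0 : R)) phi p.

(* C^1 on the open set R^n x (0, +oo). *)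
Definition C1_pos phi : Prop :=
  forall p, 0 < p.2 ->
    [/\ differentiable phi p,
        {for p, continuous (dt phi)} &
        {for p, continuous (grad_x phi)}].

(* C(R^n x [0, +oo)); values at negative times are irrelevant. *)
Definition cont_halfspace W : Prop :=
  {within [set p : 'cV[R]_n * R | 0 <= p.2], continuous W}.

(* Crandall-Lions solutions of W_t + H(x, grad_x W) = 0 for t > 0. *)
Definition viscosity_subsolution (H : 'cV[R]_n -> 'cV[R]_n -> R) W : Prop :=
  forall phi, C1_pos phi -> forall p, 0 < p.2 ->
    (\forall q \near p, W q - phi q <= W p - phi p) ->
    dt phi p + H p.1 (grad_x phi p) <= 0.

Definition viscosity_supersolution (H : 'cV[R]_n -> 'cV[R]_n -> R) W : Prop :=
  forall phi, C1_pos phi -> forall p, 0 < p.2 ->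
    (\forall q \near p, W p - phi p <= W q - phi q) ->
    0 <= dt phi p + H p.1 (grad_x phi p).

Definition viscosity_solution (H : 'cV[R]_n -> 'cV[R]_n -> R)
    (Phi : 'cV[R]_n -> R) W : Prop :=
  [/\ viscosity_subsolution H W,
      viscosity_supersolution H W &
      forall x, W (x, 0) = Phi x].

End Viscosity.

(* Main.v *)
Require Import Defs.
From HB Require Import structures.
From mathcomp Require Import all_boot all_order all_algebra.
From mathcomp Require Import all_classical all_reals all_analysis.
From mathcomp Require Import ring lra.
Set Implicit Arguments.
Unset Strict Implicit.
Unset Printing Implicit Defensive.
Import Order.TTheory GRing.Theory Num.Theory.
Import numFieldNormedType.Exports.
Local Open Scope classical_set_scope.
Local Open Scope ring_scope.

(** In the coordinates y = P^T (x - v0) the equation decouples. The unit ball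
    determines the 1-homogeneous function K, and in the basis of the u_j one
    finds K (P q) = sum_i max (a_i q_i, - b_i q_i) ([gauge_unique]); so K is
    the support function of a box of velocities, the i-th speed ranging over
    [- b_i, a_i], while the potential is |y|^2 / 2. The equation is thus the
    dynamic programming equation of an optimal control problem: a trajectory
    with bounded speeds pays |y|^2 / 2 per unit of time and Phi at its initial
    point. The function V1 is the price of the best one-dimensional trajectory
    between two fixed endpoints: run towards 0, wait there, then run to the
    end point.

    The value function is a viscosity solution. Where it is finite, V1 is given
    by one continuous formula ([cost1], [V1_cost1]), a combination of cubes of
    positive parts. As increments of z |-> max (z, 0)^3 increase with z, moving
    the end point for a time h at an extreme speed a or - b changes the cost by
    at most h x^2 / 2 + O(h^2) ([cost1_dynamic_le]), and some extreme speed
    attains this up to O(h^2) ([cost1_dynamic_ge]). Summing over the coordinates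
    with the initial point w kept fixed (w optimal at the earlier point for one
    inequality, at the later point for the other) yields infinitesimal dynamic
    programming inequalities for V ([value_dynamic_le], [value_dynamic_ge]).
    These give the viscosity inequalities at any point where V - phi has a local
    extremum, because the maximum defining K is attained at extreme velocities
    ([viscosity_subsolution_dynamic], [viscosity_supersolution_dynamic]).
    Writing w = y + t th with th in a fixed box turns V into a minimum of a
    jointly continuous function over a compact set, which gives finiteness and
    continuity ([valueE_attained], [continuous_value]).

    Uniqueness is a comparison principle without any growth condition
    ([comparison]). Variables are doubled as usual, and the maximum of the
    doubled functional is confined to a compact set by a penalty that is steep
    outside a cone: as K grows linearly, information travels at finite speed,
    and a smooth function with d/dt psi > K (- grad psi) can be small at a given
    point and yet exceed any bound outside a compact set fixed in advance
    ([escape_penalty]). *)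

(** * Inner products and limits of column vectors *)

Section InnerProduct.
Context {R : realType} {n : nat}.
Implicit Types x y z : 'cV[R]_n.

Lemma innerDl x y z : inner (x + y) z = inner x z + inner y z.
Proof. by rewrite /inner -big_split; apply: eq_bigr => i _; rewrite mxE mulrDl. Qed.

Lemma innerZl c x z : inner (c *: x) z = c * inner x z.
Proof. by rewrite /inner mulr_sumr; apply: eq_bigr => i _; rewrite mxE mulrA. Qed.

Lemma innerC x z : inner x z = inner z x.
Proof. by apply: eq_bigr => i _; rewrite mulrC. Qed.

Lemma inner_delta x i : inner x (delta_mx i 0) = x i 0.
Proof.
rewrite /inner (bigD1 i)//= mxE !eqxx mulr1 big1 ?addr0// => j /negPf ji.
by rewrite mxE ji mulr0.
Qed.

Lemma inner0r x : inner x 0 = 0.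
Proof. by rewrite /inner big1// => i _; rewrite mxE mulr0. Qed.

Lemma inner_mulmx m (A : 'M[R]_(n, m)) (x : 'cV[R]_n) (y : 'cV[R]_m) :
  inner x (A *m y) = inner (A^T *m x) y.
Proof.
rewrite /inner; under eq_bigr do rewrite mxE mulr_sumr.
rewrite exchange_big/=; apply: eq_bigr => j _; rewrite mxE mulr_suml.
by apply: eq_bigr => i _; rewrite mxE mulrCA mulrA.
Qed.

Lemma cV_sum_delta x : x = \sum_i x i 0 *: delta_mx i 0.
Proof.
by rewrite [LHS]matrix_sum_delta; apply: eq_bigr => i _; rewrite big_ord1.
Qed.

Lemma cvgr_sum (T I : Type) (F : set_system T) {FF : Filter F}
    (V : normedModType R) (r : seq I) (f : I -> T -> V) (l : I -> V) :
  (forall i, f i @ F --> l i) ->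
  (fun q => \sum_(i <- r) f i q) @ F --> \sum_(i <- r) l i.
Proof. by move=> fl; apply: cvg_big => // -[a b]; exact: add_continuous. Qed.

Lemma cV_cvgP (T : Type) (F : set_system T) {FF : Filter F}
    (g : T -> 'cV[R]_n) (l : 'cV[R]_n) :
  (forall i, (fun q => g q i 0) @ F --> l i 0) -> g @ F --> l.
Proof.
move=> gl; rewrite [l]cV_sum_delta.
rewrite (_ : g = fun q => \sum_i g q i 0 *: delta_mx i 0); last first.
  by apply/funext => q; exact: cV_sum_delta.
by apply: cvgr_sum => i; exact: cvgZr_tmp.
Qed.

End InnerProduct.

(** * Test functions with explicit derivatives *)

Section C1Calculus.
Context {R : realType} {n : nat}.
Local Notation X := 'cV[R]_n.
Implicit Types (phi psi : X * R -> R) (g : X * R -> X) (c : X * R -> R).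

(** Bundling a test function with its spatial gradient and time derivative lets
    the closure lemmas below compute the derivatives that enter the viscosity
    inequalities. *)
Definition C1_with phi g c : Prop :=
  [/\ forall p, is_diff p phi (fun v => inner (g p) v.1 + c p * v.2),
      continuous g & continuous c].

Lemma C1_with_dt phi g c p : C1_with phi g c -> dt phi p = c p.
Proof.
case=> dphi _ _; rewrite /dt deriveE; last exact: (@ex_diff _ _ _ _ _ _ _ (dphi p)).
by rewrite (@diff_val _ _ _ _ _ _ _ (dphi p))/= inner0r add0r mulr1.
Qed.

Lemma C1_with_grad phi g c p : C1_with phi g c -> grad_x phi p = g p.
Proof.
case=> dphi _ _; apply/colP => i; rewrite mxE deriveE; last first.
  exact: (@ex_diff _ _ _ _ _ _ _ (dphi p)).
by rewrite (@diff_val _ _ _ _ _ _ _ (dphi p))/= inner_delta mulr0 addr0.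
Qed.

Lemma C1_with_C1_pos phi g c : C1_with phi g c -> C1_pos phi.
Proof.
move=> H p p0; have [dphi gc cc] := H; split.
- exact: (@ex_diff _ _ _ _ _ _ _ (dphi p)).
- have -> : dt phi = c by apply/funext => q; exact: C1_with_dt H.
  exact: cc.
- have -> : grad_x phi = g by apply/funext => q; exact: C1_with_grad H.
  exact: gc.
Qed.

Lemma C1_with_continuous phi g c : C1_with phi g c -> continuous phi.
Proof.
case=> dphi _ _ p; apply: differentiable_continuous.
exact: (@ex_diff _ _ _ _ _ _ _ (dphi p)).
Qed.

Lemma C1_with_cst k : C1_with (fun=> k) (fun=> 0) (fun=> 0).
Proof.
split=> [p||]; [|exact: cst_continuous..].
apply: is_diff_eq (is_diff_cst k p) _; apply/funext => v.
by rewrite innerC inner0r mul0r addr0.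
Qed.

Lemma C1_withD phi g c psi g' c' :
  C1_with phi g c -> C1_with psi g' c' ->
  C1_with (fun q => phi q + psi q) (fun q => g q + g' q) (fun q => c q + c' q).
Proof.
move=> [d1 g1 c1] [d2 g2 c2]; split=> [p|p|p].
- apply: is_diff_eq (is_diffD (d1 p) (d2 p)) _; apply/funext => v.
  by rewrite fctE/= innerDl mulrDl addrACA.
- by apply: cvgD; [exact: g1|exact: g2].
- by apply: cvgD; [exact: c1|exact: c2].
Qed.

Lemma C1_withM phi g c psi g' c' :
  C1_with phi g c -> C1_with psi g' c' ->
  C1_with (fun q => phi q * psi q)
    (fun q => phi q *: g' q + psi q *: g q) (fun q => phi q * c' q + psi q * c q).
Proof.
move=> Hphi Hpsi; have cphi := C1_with_continuous Hphi.
have cpsi := C1_with_continuous Hpsi.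
have [d1 g1 c1] := Hphi; have [d2 g2 c2] := Hpsi.
split=> [p|p|p].
- apply: is_diff_eq (is_diffM (d1 p) (d2 p)) _; apply/funext => v.
  rewrite !fctE/= !innerDl !innerZl /GRing.scale/=; ring.
- by apply: cvgD; apply: cvgZ; [exact: cphi|exact: g2|exact: cpsi|exact: g1].
- by apply: cvgD; apply: cvgM; [exact: cphi|exact: c2|exact: cpsi|exact: c1].
Qed.

Lemma C1_with_comp phi g c (h dh : R -> R) :
  (forall z : R, is_derive z (1 : R) h (dh z)) -> continuous dh ->
  C1_with phi g c ->
  C1_with (fun q => h (phi q)) (fun q => dh (phi q) *: g q) (fun q => dh (phi q) * c q).
Proof.
move=> hd dhc Hphi; have cphi := C1_with_continuous Hphi.
have [d1 g1 c1] := Hphi.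
have cc : continuous (fun q => dh (phi q)).
  by move=> p; apply: continuous_comp; [exact: cphi|exact: dhc].
split=> [p|p|p].
- have hdiff : is_diff (phi p) h (fun k => k *: dh (phi p)).
    have [hder hval] := hd (phi p).
    split; first exact/derivable1_diffP.
    by rewrite diff1E ?derive1E ?hval//; exact/derivable1_diffP.
  apply: is_diff_eq (is_diff_comp (d1 p) hdiff) _; apply/funext => v /=.
  rewrite !innerZl /GRing.scale/=; ring.
- by apply: cvgZ; [exact: cc|exact: g1].
- by apply: cvgM; [exact: cc|exact: c1].
Qed.

Lemma C1_with_sum (I : Type) (r : seq I) (phi : I -> X * R -> R)
    (g : I -> X * R -> X) (c : I -> X * R -> R) :
  (forall i, C1_with (phi i) (g i) (c i)) ->
  C1_with (fun q => \sum_(i <- r) phi i q) (fun q => \sum_(i <- r) g i q)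
    (fun q => \sum_(i <- r) c i q).
Proof.
move=> H; elim: r => [|i r IH].
  by have := C1_with_cst 0; congr (C1_with _ _ _); apply/funext => q;
    rewrite big_nil.
by have := C1_withD (H i) IH; congr (C1_with _ _ _); apply/funext => q;
  rewrite big_cons.
Qed.

Lemma C1_with_time : C1_with (fun q => q.2) (fun=> 0) (fun=> 1).
Proof.
split=> [p||]; [|exact: cst_continuous..].
split; first exact: (@linear_differentiable _ _ _ snd _ (fun=> cvg_snd)).
rewrite (@diff_lin _ _ _ snd _ (fun=> cvg_snd)).
by apply/funext => v /=; rewrite innerC inner0r mul1r add0r.
Qed.

Lemma C1_with_coord i : C1_with (fun q => q.1 i 0) (fun=> delta_mx i 0) (fun=> 0).
Proof.
split=> [p||]; [|exact: cst_continuous..].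
have h1 : is_diff p (fst : X * R -> X) fst.
  split; first exact: (@linear_differentiable _ _ _ fst _ (fun=> cvg_fst)).
  by rewrite (@diff_lin _ _ _ fst _ (fun=> cvg_fst)).
have lin : linear (fun x : X => x i 0 : R) by move=> k x y; rewrite !mxE.
pose L : {linear X -> R} := HB.pack (fun x : X => x i 0 : R)
    (GRing.isLinear.Build _ _ _ _ _ lin).
have h2 : is_diff (p.1) (fun x : X => x i 0 : R) (fun x => x i 0).
  have cL : continuous L by exact: coord_continuous.
  by split; [exact: (@linear_differentiable _ _ _ L)|rewrite (@diff_lin _ _ _ L)].
apply: is_diff_eq (is_diff_comp h1 h2) _; apply/funext => v /=.
by rewrite innerC inner_delta mul0r addr0.
Qed.

Definition sqdist (z x : X) : R := \sum_i (x i 0 - z i 0) ^+ 2.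

Lemma C1_with_sqdist z :
  C1_with (fun q => sqdist z q.1) (fun q => 2 *: (q.1 - z)) (fun=> 0).
Proof.
have Hi i := C1_withD (C1_with_coord i) (C1_with_cst (- z i 0)).
have := C1_with_sum (index_enum 'I_n) (fun i => C1_withM (Hi i) (Hi i)).
congr (C1_with _ _ _); apply/funext => q.
- apply/colP => i; rewrite summxE (bigD1 i)//= big1 => [|j ji].
    by rewrite !mxE !eqxx /=; ring.
  by rewrite !mxE eq_sym (negPf ji) /=; ring.
- by rewrite big1// => i _; ring.
Qed.

Lemma derive_time_direction phi p (v : X) : differentiable phi p ->
  'D_(v, 1) phi p = dt phi p + inner v (grad_x phi p).
Proof.
move=> d; rewrite /dt !deriveE//.
have -> : (v, 1) = (0, 1) + \sum_i v i 0 *: (delta_mx i 0, 0) :> X * R.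
  have -> : \sum_i v i 0 *: (delta_mx i 0, 0) = (v, 0) :> X * R.
    rewrite [in RHS](cV_sum_delta v).
    elim/big_ind2 : _ => //= [x1 x2 y1 y2 -> ->|i _].
      by congr (_, _); rewrite addr0.
    by congr (_, _); exact: mulr0.
  by congr (_, _); rewrite ?add0r ?addr0.
rewrite linearD linear_sum; congr (_ + _); apply: eq_bigr => i _.
by rewrite linearZ mxE deriveE.
Qed.

(** Backward quotients along (v, 1) are what trajectories produce: the past of a
    trajectory with velocity v through p is p - h (v, 1). *)
Lemma backward_quotient phi p (v : X) : differentiable phi p ->
  (fun h => h^-1 * (phi p - phi (p - h *: (v, 1)))) @ 0^'+
    --> dt phi p + inner v (grad_x phi p).
Proof.
move=> d; rewrite -derive_time_direction//.
have /cvg_ex[l dl] : derivable phi p (v, 1) by exact: diff_derivable.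
rewrite /derive (cvg_lim _ dl)//.
have /cvg_at_leftNP := cvg_dnbhs_at_left dl.
rewrite oppr0; apply: cvg_trans; apply: near_eq_cvg; near=> h => /=.
by rewrite invrN !scaleNr -scalerN opprB [_ + p]addrC.
Unshelve. all: by end_near.
Qed.

End C1Calculus.

(** * From dynamic programming to viscosity inequalities *)

Section DynamicProgramming.
Context {R : realType} {n : nat}.
Local Notation X := 'cV[R]_n.
Variables (Vel : set X) (K f : X -> R) (W : X * R -> R).
Let H (x g : X) : R := K g - f x.

Let backward_cvg (p : X * R) (v : X) :
  (fun h : R => p - h *: ((v, 1) : X * R)) @ 0^'+ --> p.
Proof.
suff : (fun h : R => p - h *: ((v, 1) : X * R)) @ 0^'+ -->
  p - 0 *: ((v, 1) : X * R) by rewrite scale0r subr0.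
apply: cvgB; first exact: cvg_cst.
by apply: cvgZr_tmp; apply: cvg_at_right_filter; exact: cvg_id.
Qed.

Let affine_cvg (l C : R) : (fun h : R => l + C * h) @ 0^'+ --> l.
Proof.
suff : (fun h : R => l + C * h) @ 0^'+ --> l + C * 0 by rewrite mulr0 addr0.
apply: cvgD; first exact: cvg_cst.
apply: cvgM; first exact: cvg_cst.
by apply: cvg_at_right_filter; exact: cvg_id.
Qed.

(** At a local maximum of W - phi, going back in time decreases phi by at most as
    much as W, so the derivative of phi along (v, 1) is at most the running cost
    f; choosing the velocity v that attains K (grad phi) gives the claim. *)
Lemma viscosity_subsolution_dynamic :
  (forall g, exists2 v, Vel v & inner v g = K g) ->
  (forall p v, 0 < p.2 -> Vel v -> exists C, \forall h \near 0^'+,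
     W p <= W (p - h *: ((v, 1) : X * R)) + h * f p.1 + C * h ^+ 2) ->
  viscosity_subsolution H W.
Proof.
move=> KV dyn phi phiC p p0 pmax; have [dphi _ _] := phiC _ p0.
have [v vV] := KV (grad_x phi p); rewrite /H => <-.
rewrite addrA subr_le0.
have [C dynC] := dyn _ _ p0 vV.
apply: (ler_cvg_to (backward_quotient (v := v) dphi) (@affine_cvg (f p.1) C)).
have pmax' : \forall h \near (0 : R)^'+,
    W (p - h *: ((v, 1) : X * R)) - phi (p - h *: ((v, 1) : X * R)) <= W p - phi p.
  exact: (@backward_cvg p v) pmax.
apply: filterS3 (nbhs_right_gt 0) dynC pmax' => h h0 h1 h2.
rewrite mulrC ler_pdivrMr//.
rewrite mulrDl -mulrA -expr2; lra.
Qed.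

(** The mirror image: here one good velocity v for W is enough, since
    K (grad phi) dominates its inner product with grad phi. *)
Lemma viscosity_supersolution_dynamic :
  (forall v g, Vel v -> inner v g <= K g) ->
  (forall p, 0 < p.2 -> exists2 v, Vel v & exists C, \forall h \near 0^'+,
     W (p - h *: ((v, 1) : X * R)) + h * f p.1 <= W p + C * h ^+ 2) ->
  viscosity_supersolution H W.
Proof.
move=> KV dyn phi phiC p p0 pmin; have [dphi _ _] := phiC _ p0.
have [v vV [C dynC]] := dyn _ p0.
rewrite /H addrA subr_ge0.
apply: (@le_trans _ _ (dt phi p + inner v (grad_x phi p))); last first.
  by rewrite lerD2l; exact: KV.
apply: (ler_cvg_to (@affine_cvg (f p.1) (- C)) (backward_quotient (v := v) dphi)).
have pmin' : \forall h \near (0 : R)^'+,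
    W p - phi p <= W (p - h *: ((v, 1) : X * R)) - phi (p - h *: ((v, 1) : X * R)).
  exact: (@backward_cvg p v) pmin.
apply: filterS3 (nbhs_right_gt 0) dynC pmin' => h h0 h1 h2.
rewrite [leRHS]mulrC ler_pdivlMr//.
rewrite mulrDl -mulrA -expr2; lra.
Qed.

End DynamicProgramming.

(** * Uniformity on compact sets *)

Section Compactness.
Context {R : realType}.

Lemma near_compact_uniform (U T : topologicalType) (G : U * T -> R)
    (A : set T) (x0 : U) (e : R) :
  compact A -> (forall th, A th -> {for (x0, th), continuous G}) -> 0 < e ->
  \forall x \near x0, forall th, A th -> `|G (x, th) - G (x0, th)| < e.
Proof.
move=> /compact_near_coveringP cA cG e0.
apply: (cA U (nbhs x0) (fun x th => `|G (x, th) - G (x0, th)| < e)) => th Ath.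
have /cvgrPdist_lt /(_ (e / 2)) := cG th Ath.
rewrite divr_gt0// => /(_ isT) [[U1 U2] /= [U1x U2t] U12].
exists (U2, U1) => // -[th' x] /= [U2th U1x'].
have h1 := U12 (x, th') (conj U1x' U2th).
have h2 := U12 (x0, th') (conj (nbhs_singleton U1x) U2th).
rewrite [e]splitr -(subrK (G (x0, th)) (G (x, th'))) -addrA.
apply: le_lt_trans (ler_normD _ _) _; apply: ltrD => //.
by rewrite distrC.
Qed.

Lemma compact_uniform_translation (T : normedModType R) (F : T -> R)
    (A : set T) (e : R) :
  compact A -> continuous F -> 0 < e ->
  \forall z \near (0 : T), forall p, A p -> `|F (p + z) - F p| < e.
Proof.
move=> cA cF e0.
have cG p : A p -> {for (0, p), continuous (fun q : T * T => F (q.2 + q.1))}.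
  move=> _; apply: continuous_comp; last exact: cF.
  by apply: cvgD; [exact: cvg_snd|exact: cvg_fst].
apply: filterS (near_compact_uniform cA cG e0) => z Hz p /Hz /=.
by rewrite addr0.
Qed.

Lemma cV_box_compact n (lo hi : 'I_n -> R) :
  compact [set w : 'cV[R]_n | forall i, lo i <= w i 0 <= hi i].
Proof.
have cB := @rV_compact R n (fun i => `[lo i, hi i]%classic)
  (fun i => @segment_compact R _ _).
have ctr : continuous (@trmx R 1 n).
  move=> v; apply: (@cV_cvgP _ _ _ (nbhs v)) => i; rewrite mxE.
  by under eq_fun do rewrite mxE; exact: coord_continuous.
have := continuous_compact (continuous_subspaceT ctr) cB.
congr compact; apply/seteqP; split => [_ [v /= vB <-] i|w /= wB].
  by rewrite mxE; have := vB i; rewrite /= in_itv.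
exists w^T; last exact: trmxK.
by move=> i /=; rewrite in_itv/= mxE.
Qed.

End Compactness.

(** * The comparison principle *)

Section TestFunctions.
Context {R : realType} {n : nat}.
Local Notation X := 'cV[R]_n.

Lemma C1_with_quadratic (N s : R) (z : X) :
  C1_with (fun q => N * (sqdist z q.1 + (q.2 - s) ^+ 2))
    (fun q => (N * 2) *: (q.1 - z)) (fun q => N * 2 * (q.2 - s)).
Proof.
have T := C1_withD (@C1_with_time R n) (C1_with_cst (- s)).
have := C1_withM (C1_with_cst N) (C1_withD (C1_with_sqdist z) (C1_withM T T)).
congr (C1_with _ _ _); apply/funext => q.
- by apply/colP => i; rewrite !mxE; ring.
- by ring.
Qed.

Lemma C1_with_affine_exp (k c : R) phi g d :
  C1_with phi g d ->
  C1_with (fun q : X * R => expR (k * phi q + c))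
    (fun q => (k * expR (k * phi q + c)) *: g q)
    (fun q => k * expR (k * phi q + c) * d q).
Proof.
move=> H.
have := C1_with_comp (@is_derive_expR R) (@continuous_expR R)
  (C1_withD (C1_withM (C1_with_cst k) H) (C1_with_cst c)).
congr (C1_with _ _ _); apply/funext => q.
- by apply/colP => i; rewrite !mxE; ring.
- by ring.
Qed.

(** The level sets of this function shrink around z as time grows; the rate B
    plays the role of the propagation speed. *)
Definition cone_fun (B : R) (z : X) (q : X * R) : R :=
  (1 + sqdist z q.1) * expR (B * q.2).

Lemma C1_with_cone B z :
  C1_with (cone_fun B z) (fun q => (2 * expR (B * q.2)) *: (q.1 - z))
    (fun q => B * cone_fun B z q).
Proof.
have E := @C1_with_affine_exp B 0 _ _ _ (@C1_with_time R n).
have := C1_withM (C1_withD (C1_with_cst 1) (C1_with_sqdist z)) E.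
congr (C1_with _ _ _); apply/funext => q; rewrite /cone_fun ?addr0//.
- by apply/colP => i; rewrite !mxE; ring.
- by ring.
Qed.

Lemma sqdist_ge0 (z x : X) : 0 <= sqdist z x.
Proof. by apply: sumr_ge0 => i _; exact: sqr_ge0. Qed.

Lemma sqdist_coord (z x : X) i : (x i 0 - z i 0) ^+ 2 <= sqdist z x.
Proof.
by rewrite /sqdist (bigD1 i)//= lerDl sumr_ge0// => j _; exact: sqr_ge0.
Qed.

(** The gradient is 2 exp (B t) (x - z), on which K is at most
    L exp (B t) sum_i 2 |x_i - z_i|, and 2 |d| <= 1 + d^2 bounds this by a
    multiple of the function itself; its time derivative is B times itself. *)
Lemma cone_fun_eikonal (K : X -> R) (L B : R) z q :
  (forall (c : R) (p : X), 0 < c -> K (c *: p) = c * K p) ->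
  (forall p, K p <= L * \sum_i `|p i 0|) -> 0 <= L ->
  L * n%:R + L <= B ->
  K (- ((2 * expR (B * q.2)) *: (q.1 - z))) <= B * cone_fun B z q.
Proof.
move=> Khom KL L0 LB.
have -> : - ((2 * expR (B * q.2)) *: (q.1 - z)) = expR (B * q.2) *: (2 *: (z - q.1)).
  by rewrite scalerA mulrC -scalerN opprB.
rewrite Khom ?expR_gt0// /cone_fun (mulrC _ (expR _)) mulrCA.
rewrite ler_pM2l ?expR_gt0//.
apply: le_trans (KL _) _.
have S0 := sqdist_ge0 z q.1.
apply: (@le_trans _ _ (L * (n%:R + sqdist z q.1))); last first.
  have : 0 <= (B - L * n%:R - L) * (1 + sqdist z q.1) by apply: mulr_ge0; lra.
  have : 0 <= (L * n%:R) * sqdist z q.1 by rewrite !mulr_ge0.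
  lra.
rewrite ler_wpM2l// /sqdist.
have -> : n%:R = \sum_(i < n) (1 : R) by rewrite sumr_const card_ord.
rewrite -big_split; apply: ler_sum => i _ /=; rewrite !mxE.
set d := q.1 i 0 - z i 0.
have -> : 2 * (z i 0 - q.1 i 0) = - (2 * d) by rewrite /d; ring.
rewrite normrN -real_normK ?num_real// normrM (ger0_norm (_ : 0 <= 2))//.
have := sqr_ge0 (`|d| - 1); lra.
Qed.

End TestFunctions.

Section Slab.
Context {R : realType} {n : nat}.
Local Notation X := 'cV[R]_n.

Definition slab (z : X) (rho : R) : set (X * R) :=
  [set q : X * R | (forall i, - rho <= q.1 i 0 - z i 0 <= rho) /\ 0 <= q.2 <= rho].

Lemma compact_slab (z : X) rho : compact (slab z rho).
Proof.
have := compact_setX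
  (@cV_box_compact R n (fun i => z i 0 - rho) (fun i => z i 0 + rho))
  (@segment_compact R 0 rho).
congr compact; apply/seteqP; split => -[x t] /= [xB tB]; split.
- by move=> i; have /andP[? ?] := xB i; apply/andP; split; lra.
- by move: tB; rewrite in_itv.
- by move=> i; have /andP[? ?] := xB i; apply/andP; split; lra.
- by rewrite in_itv.
Qed.

Lemma near_slab (z : X) rho (q : X * R) :
  (forall i, - rho < q.1 i 0 - z i 0 < rho) -> 0 < q.2 < rho ->
  \forall q' \near q, slab z rho q'.
Proof.
move=> xB /andP[t0 t1].
have c2 : (fun q' : X * R => q'.2) @ q --> q.2 by exact: cvg_snd.
have c1 i : (fun q' : X * R => q'.1 i 0 - z i 0) @ q --> q.1 i 0 - z i 0.
  apply: cvgB; last exact: cvg_cst.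
  apply: (@continuous_comp _ _ _ fst (fun x : X => x i 0)).
    exact: cvg_fst.
  exact: coord_continuous.
have h1 : nbhs q [set q' : X * R | forall i, - rho <= q'.1 i 0 - z i 0 <= rho].
  apply: (@filter_forall _ _
    (fun i (q' : X * R) => - rho <= q'.1 i 0 - z i 0 <= rho)
    (nbhs q) (nbhs_filter q)) => i; have /andP[l u] := xB i.
  by apply: filterS2 (cvgr_ge _ (c1 i) _ l) (cvgr_le _ (c1 i) _ u) => q' -> ->.
apply: filterS3 h1 (cvgr_ge _ c2 _ t0) (cvgr_le _ c2 _ t1) => q' ? ? ?.
by split=> //; apply/andP.
Qed.

Lemma sqdistC (z x : X) : sqdist z x = sqdist x z.
Proof. by apply: eq_bigr => i _; rewrite -sqrrN opprB. Qed.

Lemma continuous_sqdist (T : topologicalType) (g h : T -> X) :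
  continuous g -> continuous h -> continuous (fun q => sqdist (g q) (h q)).
Proof.
move=> cg ch q; apply: cvgr_sum => i.
have ci (k : T -> X) : continuous k -> (fun q => k q i 0) @ q --> k q i 0.
  move=> ck; apply: (@continuous_comp _ _ _ k (fun x : X => x i 0)).
    exact: ck.
  exact: coord_continuous.
have cd : (fun q => h q i 0 - g q i 0) @ q --> h q i 0 - g q i 0.
  by apply: cvgB; exact: ci.
rewrite expr2; under eq_fun do rewrite expr2; exact: cvgM.
Qed.

Lemma sqdist_ball (p q : X * R) (d : R) : 0 < d ->
  sqdist q.1 p.1 + (p.2 - q.2) ^+ 2 < d ^+ 2 -> ball (0 : X * R) d (p - q).
Proof.
move=> d0 lt.
have abs_lt x : x ^+ 2 < d ^+ 2 -> `|x| < d.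
  by rewrite -(real_normK (num_real x)) ltr_pXn2r// ?nnegrE ?ltW.
have S0 := sqdist_ge0 q.1 p.1.
split => /=.
- split=> // i j; rewrite !mxE /ball/= sub0r normrN ord1.
  apply: abs_lt; apply: le_lt_trans lt.
  by apply: le_trans (sqdist_coord q.1 p.1 i) _; rewrite lerDl sqr_ge0.
- rewrite /ball/= sub0r normrN; apply: abs_lt; lra.
Qed.

End Slab.

Definition sublinear (R : realType) (n : nat) (K : 'cV[R]_n -> R) : Prop :=
  (forall p q, K (p + q) <= K p + K q) /\
  (forall (c : R) p, 0 < c -> K (c *: p) = c * K p).

(** The set outside which the penalty is large depends on rho only, which is
    fixed before the bound M: in [comparison] the number M bounds the solutions
    on the slab of size rho. The penalty is exp (k (G - r0 - 1)) + eta t with G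
    a [cone_fun] and r0 its value at (x0, t0); it is at most exp (- k) + s there
    and at least exp k where G >= r0 + 2, so it is enough to take k large. *)
Lemma escape_penalty (R : realType) (n : nat) (K : 'cV[R]_n -> R) (L : R)
    (x0 : 'cV[R]_n) (t0 : R) :
  sublinear K -> 0 <= L -> (forall p, K p <= L * \sum_i `|p i 0|) ->
  0 < t0 -> exists2 rho, t0 < rho &
  forall s M, 0 < s -> 0 <= M -> exists psi g c, exists2 eta, 0 < eta &
    [/\ C1_with psi g c, forall q, K (- g q) + eta <= c q,
        psi (x0, t0) <= 2 * s, forall q, 0 <= q.2 -> 0 <= psi q &
        forall q, 0 <= q.2 -> psi q < M + 1 ->
          (forall i, `|q.1 i 0 - x0 i 0| < rho - 1) /\ q.2 < rho - 1].
Proof.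
move=> [_ K_hom] L_ge0 K_bound t0gt.
pose B := L * n%:R + L + 1.
have B1 : 1 <= B by rewrite /B lerDr addr_ge0// mulr_ge0.
pose G := cone_fun B x0.
have G_ge q : 0 <= q.2 -> 1 + sqdist x0 q.1 <= G q /\ 1 + q.2 <= G q.
  move=> q2; have S0 := sqdist_ge0 x0 q.1.
  have E1 : 1 + q.2 <= expR (B * q.2).
    by apply: le_trans (expR_ge1Dx _); rewrite lerD2l ler_peMl.
  have SE : 0 <= sqdist x0 q.1 * (expR (B * q.2) - 1).
    by rewrite mulr_ge0//; clear - E1 q2; lra.
  by rewrite /G /cone_fun; split; clear - SE E1 S0 q2; lra.
pose r0 := G (x0, t0).
have r0t : 1 + t0 <= r0 by have [] := G_ge (x0, t0) (ltW t0gt).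
exists (r0 + 3); first lra.
move=> s M s0 M0.
(* Both exp (- k) <= s and exp k >= M + 1 follow from exp k >= 1 + k. *)
pose k := s^-1 + M + 1.
have sV0 : 0 < s^-1 by rewrite invr_gt0.
have k0 : 0 < k by rewrite /k; lra.
pose c := - (k * (r0 + 1)).
pose eta := s / t0.
have eta0 : 0 < eta by rewrite divr_gt0.
have HG := C1_with_cone B x0.
have Hpsi := C1_withD (C1_with_affine_exp k c HG)
  (C1_withM (C1_with_cst eta) (@C1_with_time R n)).
set psi := (fun q : 'cV[R]_n * R => _) in Hpsi.
set g := (fun q : 'cV[R]_n * R => _) in Hpsi.
set d := (fun q : 'cV[R]_n * R => _) in Hpsi.
exists psi, g, d, eta => //; split=> //.
- move=> q; rewrite /g /d !scaler0 !addr0 mulr1 mulr0 addr0 lerD2r -scalerN.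
  have e0 : 0 < k * expR (k * cone_fun B x0 q + c).
    by rewrite mulr_gt0// expR_gt0.
  rewrite K_hom// ler_pM2l//; apply: (cone_fun_eikonal _ _ K_hom K_bound) => //.
  by rewrite /B lerDl.
- rewrite /psi /= -/G -/r0 /eta divfK ?gt_eqF//.
  have -> : k * r0 + c = - k by rewrite /c; ring.
  have : (expR k)^-1 <= s.
    rewrite invf_ple ?posrE ?expR_gt0//.
    by apply: le_trans (expR_ge1Dx _); rewrite /k; lra.
  rewrite expRN; lra.
- by move=> q q2; rewrite /psi addr_ge0 ?expR_ge0// mulr_ge0// ltW.
- move=> q q2 psi_lt; have [G1 G2] := G_ge q q2.
  have Glt : G q < r0 + 2.
    rewrite ltNge; apply/negP => Gq.
    have eq0 : 0 <= eta * q.2 by rewrite mulr_ge0// ltW.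
    have : expR k <= expR (k * G q + c).
      have : 0 <= k * (G q - (r0 + 2)) by rewrite mulr_ge0 ?subr_ge0// ltW.
      rewrite ler_expR /c; clear; lra.
    have k1 := expR_ge1Dx k.
    move: psi_lt; rewrite /psi -/G; move: k1; rewrite /k.
    move: (expR _) (expR _) => e1 e2; clear - sV0 eq0; lra.
  split=> [i|]; last by clear - Glt G2; lra.
  rewrite -(@ltr_pXn2r _ 2)// ?nnegrE//; last by clear - r0t t0gt; lra.
  rewrite real_normK ?num_real//; apply: le_lt_trans (sqdist_coord _ _ _) _.
  have -> : r0 + 3 - 1 = r0 + 2 by ring.
  have r0_gt0 : 0 <= (r0 + 1) * (r0 + 2) by apply: mulr_ge0; clear - r0t t0gt; lra.
  rewrite expr2; clear - G1 Glt r0_gt0; lra.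
Qed.

(** Comparing the maximum with the value on the diagonal at P0 bounds N times
    the squared distance from p to q by M, so a large N forces the two points of
    the maximum to be close to each other. *)
Lemma doubled_maximum (R : realType) (n : nat)
    (W1 W2 psi : 'cV[R]_n * R -> R) (A : set ('cV[R]_n * R)) P0 M s d :
  compact A -> continuous W1 -> continuous W2 -> continuous psi ->
  A P0 -> (forall p q, A p -> A q -> W1 p - W2 q <= M) -> 0 <= M ->
  (forall p, A p -> 0 <= psi p) -> 0 < s -> 0 < d ->
  s <= W1 P0 - W2 P0 - psi P0 ->
  exists N p q,
   [/\ A p /\ A q, ball (0 : 'cV[R]_n * R) d (q - p), ball (0 : 'cV[R]_n * R) d (p - q),
       s + psi p <= W1 p - W2 q &
       forall p' q', A p' -> A q' ->
         W1 p' - W2 q' - N * (sqdist q'.1 p'.1 + (p'.2 - q'.2) ^+ 2) - psi p' <=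
         W1 p - W2 q - N * (sqdist q.1 p.1 + (p.2 - q.2) ^+ 2) - psi p].
Proof.
move=> cA cW1 cW2 cpsi AP0 MW M0 psi_ge0 s0 d0 sP0.
pose N := (M + 1) / d ^+ 2.
have N0 : 0 < N by rewrite divr_gt0 ?exprn_gt0// ltr_wpDl.
pose F (z : ('cV[R]_n * R) * ('cV[R]_n * R)) :=
  W1 z.1 - W2 z.2 - N * (sqdist z.2.1 z.1.1 + (z.1.2 - z.2.2) ^+ 2) - psi z.1.
have cF : continuous F.
  pose Z := (('cV[R]_n * R) * ('cV[R]_n * R))%type.
  have c1 : continuous (fun z : Z => z.1) by move=> z; exact: cvg_fst.
  have c2 : continuous (fun z : Z => z.2) by move=> z; exact: cvg_snd.
  have c11 : continuous (fun z : Z => z.1.1).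
    by move=> z; apply: (@continuous_comp _ _ _ fst fst); exact: cvg_fst.
  have c12 : continuous (fun z : Z => z.1.2).
    move=> z; apply: (@continuous_comp _ _ _ fst snd); first exact: cvg_fst.
    exact: cvg_snd.
  have c21 : continuous (fun z : Z => z.2.1).
    move=> z; apply: (@continuous_comp _ _ _ snd fst); first exact: cvg_snd.
    exact: cvg_fst.
  have c22 : continuous (fun z : Z => z.2.2).
    by move=> z; apply: (@continuous_comp _ _ _ snd snd); exact: cvg_snd.
  move=> z; apply: cvgB; [apply: cvgB; [apply: cvgB|]|].
  - by apply: continuous_comp; [exact: c1|exact: cW1].
  - by apply: continuous_comp; [exact: c2|exact: cW2].
  - apply: cvgM; first exact: cvg_cst.
    apply: cvgD; first exact: (continuous_sqdist c21 c11).
    rewrite expr2; under eq_fun do rewrite expr2.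
    by apply: cvgM; apply: cvgB; [exact: c12|exact: c22|exact: c12|exact: c22].
  - by apply: continuous_comp; [exact: c1|exact: cpsi].
have AA0 : A `*` A !=set0 by exists (P0, P0).
have [[p q] /set_mem[/= Ap Aq] pqmax] :=
  compact_EVT_max AA0 (compact_setX cA cA) (continuous_subspaceT cF).
have {}pqmax p' q' : A p' -> A q' -> F (p', q') <= F (p, q).
  by move=> ? ?; apply: pqmax; apply/mem_set.
have F_ge : s <= F (p, q).
  apply: le_trans (pqmax _ _ AP0 AP0); rewrite /F/= subrr expr0n addr0.
  have -> : sqdist P0.1 P0.1 = 0 by rewrite /sqdist big1// => i _; rewrite subrr expr0n.
  by rewrite mulr0 subr0.
have MWpq := MW _ _ Ap Aq; have psip := psi_ge0 _ Ap.
move: F_ge; rewrite /F/=; set D := sqdist q.1 p.1 + (p.2 - q.2) ^+ 2 => F_ge.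
have D0 : 0 <= D by rewrite addr_ge0 ?sqdist_ge0 ?sqr_ge0.
have ND0 : 0 <= N * D by rewrite mulr_ge0// ltW.
have Dlt : D < d ^+ 2.
  rewrite -(ltr_pM2l N0).
  have -> : N * d ^+ 2 = M + 1 by rewrite /N divfK ?gt_eqF ?exprn_gt0.
  clear - F_ge psip MWpq s0; lra.
exists N, p, q; split=> //.
- apply: sqdist_ball => //; rewrite sqdistC.
  by rewrite -[(q.2 - p.2) ^+ 2]sqrrN opprB.
- exact: sqdist_ball.
- clear - F_ge ND0; lra.
Qed.

(** Apart from psi, the test functions touching W1 at p and W2 at q have there the
    same time derivative and the same gradient 2 N (p.1 - q.1). Subtracting the
    two viscosity inequalities thus leaves psi alone, by subadditivity of K. *)
Lemma doubling_inequality (R : realType) (n : nat) (K f : 'cV[R]_n -> R)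
    (W1 W2 psi : 'cV[R]_n * R -> R) g c (A : set ('cV[R]_n * R))
    (N : R) (p q : 'cV[R]_n * R) :
  let H x g := K g - f x in sublinear K ->
  viscosity_subsolution H W1 -> viscosity_supersolution H W2 ->
  C1_with psi g c -> 0 < p.2 -> 0 < q.2 ->
  (\forall p' \near p, A p') -> (\forall q' \near q, A q') ->
  (forall p' q', A p' -> A q' ->
     W1 p' - W2 q' - N * (sqdist q'.1 p'.1 + (p'.2 - q'.2) ^+ 2) - psi p' <=
     W1 p - W2 q - N * (sqdist q.1 p.1 + (p.2 - q.2) ^+ 2) - psi p) ->
  c p - K (- g p) <= f p.1 - f q.1.
Proof.
move=> H [K_add _] sub sup Hpsi pgt qgt nearp nearq pqmax.
have Ap := nbhs_singleton nearp; have Aq := nbhs_singleton nearq.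
have Hphi1 := C1_withD (C1_with_quadratic N q.2 q.1) Hpsi.
have Hphi2 := C1_with_quadratic (- N) p.2 p.1.
have := sub _ (C1_with_C1_pos Hphi1) p pgt.
rewrite (C1_with_dt _ Hphi1) (C1_with_grad _ Hphi1) /H.
have := sup _ (C1_with_C1_pos Hphi2) q qgt.
rewrite (C1_with_dt _ Hphi2) (C1_with_grad _ Hphi2) /H.
have supq : \forall q' \near q, W2 q - - N * (sqdist p.1 q.1 + (q.2 - p.2) ^+ 2) <=
   W2 q' - - N * (sqdist p.1 q'.1 + (q'.2 - p.2) ^+ 2).
  apply: filterS nearq => q' Aq'; have := pqmax _ _ Ap Aq'.
  rewrite !(sqdistC p.1) -![(_ - p.2) ^+ 2]sqrrN !opprB; clear; lra.
move=> /(_ supq) sup_ineq.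
have subp : \forall p' \near p,
   W1 p' - (N * (sqdist q.1 p'.1 + (p'.2 - q.2) ^+ 2) + psi p') <=
   W1 p - (N * (sqdist q.1 p.1 + (p.2 - q.2) ^+ 2) + psi p).
  by apply: filterS nearp => p' Ap'; have := pqmax _ _ Ap' Aq; clear; lra.
move=> /(_ subp) sub_ineq.
have Kle : K ((- N * 2) *: (q.1 - p.1)) <=
    K ((N * 2) *: (p.1 - q.1) + g p) + K (- g p).
  rewrite mulNr scaleNr -scalerN opprB; apply: le_trans (K_add _ _).
  by rewrite addrK.
move: sub_ineq sup_ineq Kle; clear; lra.
Qed.

(** If W1 exceeded W2 somewhere, the doubled maximum would be interior: the
    penalty keeps it away from the boundary of the slab, and the initial
    inequality with the uniform continuity of W1 and W2 keeps it away from
    t = 0. [doubling_inequality] then bounds eta by a difference of values of f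
    at two nearby points, which is smaller than eta. *)
Lemma comparison (R : realType) (n : nat) (K f : 'cV[R]_n -> R) (L : R)
    (W1 W2 : 'cV[R]_n * R -> R) :
  let H x g := K g - f x in
  sublinear K -> 0 <= L -> (forall p, K p <= L * \sum_i `|p i 0|) ->
  continuous f ->
  continuous W1 -> continuous W2 ->
  viscosity_subsolution H W1 -> viscosity_supersolution H W2 ->
  (forall x, W1 (x, 0) <= W2 (x, 0)) ->
  forall x t, 0 <= t -> W1 (x, t) <= W2 (x, t).
Proof.
move=> H K_sub L_ge0 K_bound f_cont cW1 cW2 sub sup init x0 t0.
rewrite le_eqVlt => /predU1P[<-//|t0gt].
rewrite leNgt; apply/negP => lt0.
pose s := (W1 (x0, t0) - W2 (x0, t0)) / 4.
have sE : W1 (x0, t0) - W2 (x0, t0) = 4 * s by rewrite /s; field.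
have s0 : 0 < s by rewrite /s divr_gt0// subr_gt0.
have [rho rho_t Hbar] := escape_penalty x0 K_sub L_ge0 K_bound t0gt.
pose A := slab x0 rho.
have cA : compact A by exact: compact_slab.
have P0A : A (x0, t0).
  split=> [i|] /=; last by clear - t0gt rho_t; lra.
  by rewrite subrr; clear - t0gt rho_t; lra.
have [M M0 MW] : exists2 M, 0 <= M & forall p q, A p -> A q -> W1 p - W2 q <= M.
  have A0 : A !=set0 by exists (x0, t0).
  have [c1 _ m1] := compact_EVT_max A0 cA (continuous_subspaceT cW1).
  have [c2 _ m2] := compact_EVT_min A0 cA (continuous_subspaceT cW2).
  exists `|W1 c1 - W2 c2| => // p q Ap Aq.
  apply: le_trans (ler_norm _); apply: lerB; [apply: m1|apply: m2]; exact/mem_set.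
have [psi [g [c [eta eta0 [Hpsi Heta psi_P0 psi_ge0 psi_conf]]]]] := Hbar s M s0 M0.
have cf1 : continuous (fun p : 'cV[R]_n * R => f p.1).
  by move=> p; apply: continuous_comp; [exact: cvg_fst|exact: f_cont].
have [d d0 Hd] : exists2 d, 0 < d & forall p q, A p ->
    ball (0 : 'cV[R]_n * R) d (q - p) ->
    [/\ `|W1 q - W1 p| < s, `|W2 q - W2 p| < s & `|f q.1 - f p.1| < eta].
  have FF := nbhs_filter (0 : 'cV[R]_n * R).
  have := @filterI _ _ FF _ _ (compact_uniform_translation cA cW1 s0)
    (@filterI _ _ FF _ _ (compact_uniform_translation cA cW2 s0)
       (compact_uniform_translation cA cf1 eta0)).
  move=> /nbhs_ballP[d d0 Hd]; exists d => // p q Ap /Hd[h1 [h2 h3]].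
  have := h1 _ Ap; have := h2 _ Ap; have := h3 _ Ap.
  by rewrite (addrC p) subrK.
(* At distance less than 1 from p, which is at depth 1 in the slab, the point q
   is interior too. *)
pose dd := Num.min d 1.
have dd0 : 0 < dd by rewrite lt_min d0 ltr01.
have ddd : dd <= d by rewrite ge_min lexx.
have dd1 : dd <= 1 by rewrite ge_min lexx orbT.
have psiA p : A p -> 0 <= psi p by case=> _ /andP[? _]; exact: psi_ge0.
have sP0 : 2 * s <= W1 (x0, t0) - W2 (x0, t0) - psi (x0, t0).
  by rewrite sE; clear - psi_P0; lra.
have s20 : 0 < 2 * s by rewrite mulr_gt0.
have [N [p [q [[Ap Aq] bqp bpq spq pqmax]]]] :=
  doubled_maximum cA cW1 cW2 (C1_with_continuous Hpsi) P0A MW M0 psiA s20 dd0 sP0.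
have [_ /andP[p2 _]] := Ap; have [_ /andP[q2 _]] := Aq.
have psip := psiA _ Ap; have MWpq := MW _ _ Ap Aq.
have pgt : 0 < p.2.
  rewrite lt_neqAle p2 andbT; apply/eqP => p20.
  have [_ + _] := Hd _ _ Ap (le_ball ddd bqp).
  rewrite ltr_norml => /andP[+ _].
  have := init p.1; rewrite p20 -!surjective_pairing.
  clear - psip spq s0; lra.
have qgt : 0 < q.2.
  rewrite lt_neqAle q2 andbT; apply/eqP => q20.
  have [+ _ _] := Hd _ _ Aq (le_ball ddd bpq).
  rewrite ltr_norml => /andP[_ +].
  have := init q.1; rewrite q20 -!surjective_pairing.
  clear - psip spq s0; lra.
have [pint pt] : (forall i, `|p.1 i 0 - x0 i 0| < rho - 1) /\ p.2 < rho - 1.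
  by apply: psi_conf => //; clear - spq MWpq s0; lra.
have [[_ bx] bt] := bqp.
have {}bt : `|q.2 - p.2| < 1.
  by apply: lt_le_trans dd1; move: bt; rewrite /ball/= sub0r normrN.
have {}bx i : `|q.1 i 0 - p.1 i 0| < 1.
  by apply: lt_le_trans dd1; move: (bx i 0); rewrite /ball/= !mxE sub0r normrN.
have nearp : \forall p' \near p, A p'.
  apply: near_slab; last by rewrite pgt/=; clear - pt; lra.
  move=> i; move: (pint i); rewrite -ltr_norml => /lt_le_trans; apply.
  by rewrite gerBl.
have nearq : \forall q' \near q, A q'.
  apply: near_slab.
    move=> i; rewrite -ltr_norml -(subrK (p.1 i 0) (q.1 i 0)) -addrA.
    apply: le_lt_trans (ler_normD _ _) _.
    have rhoE : rho = 1 + (rho - 1) by ring.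
    by rewrite [ltRHS]rhoE ltrD.
  rewrite qgt/=; move: bt; rewrite ltr_norml => /andP[_].
  by clear - pt; lra.
have := doubling_inequality K_sub sub sup Hpsi pgt qgt nearp nearq pqmax.
have := Heta p; have [_ _] := Hd _ _ Ap (le_ball ddd bqp).
rewrite ltr_norml => /andP[+ _]; clear; lra.
Qed.


(** * The one-dimensional cost *)

Section OneDimensionalFormula.
Context {R : realType}.
Implicit Types (x t u a b h v z : R).

Definition pcube z : R := Num.max z 0 ^+ 3.

Lemma pcube_nneg z : 0 <= z -> pcube z = z ^+ 3.
Proof. by move=> z0; rewrite /pcube max_l. Qed.

Lemma pcube_npos z : z <= 0 -> pcube z = 0.
Proof. by move=> z0; rewrite /pcube max_r// expr0n. Qed.

Lemma pcubeBN z : pcube z - pcube (- z) = z ^+ 3.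
Proof.
have [z0|/ltW z0] := leP 0 z.
  by rewrite pcube_nneg// [pcube (- z)]pcube_npos ?oppr_le0// subr0.
by rewrite pcube_npos// pcube_nneg ?oppr_ge0//; ring.
Qed.

Lemma pcube_ge0 z : 0 <= pcube z.
Proof. by rewrite exprn_ge0// le_max lexx orbT. Qed.

Lemma pcube_le z z' : z <= z' -> pcube z <= pcube z'.
Proof.
by move=> zz; apply: lerXn2r;
  rewrite ?nnegrE ?ge_max ?le_max ?zz ?lexx ?orbT.
Qed.

(** This monotonicity is the convexity of z |-> max (z, 0)^3. *)
Lemma pcube_increment z z' h : 0 <= h -> z <= z' ->
  pcube (z + h) - pcube z <= pcube (z' + h) - pcube z'.
Proof.
move=> h0 zz.
have [z0|/ltW z0] := leP 0 z.
  rewrite !pcube_nneg; try lra.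
  have : 0 <= (z' - z) * (h * (z + z') + h ^+ 2).
    by apply: mulr_ge0; [lra|rewrite addr_ge0 ?mulr_ge0 ?sqr_ge0//; lra].
  lra.
rewrite (pcube_npos z0) subr0.
have [z'0|/ltW z'0] := leP 0 z'.
  apply: (@le_trans _ _ (pcube h)); first by apply: pcube_le; lra.
  rewrite !pcube_nneg; try lra.
  have : 0 <= z' * (h * z' + h ^+ 2).
    by rewrite mulr_ge0// addr_ge0 ?mulr_ge0 ?sqr_ge0.
  lra.
by rewrite (pcube_npos z'0) subr0; apply: pcube_le; lra.
Qed.

Lemma continuous_max0 : continuous (fun z : R => Num.max z 0).
Proof.
move=> z; have H := @continuous_max R R id (fun=> 0 : R) z.
by apply: H; [exact: cvg_id|exact: cvg_cst].
Qed.

Lemma continuous_pcube : continuous pcube.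
Proof.
move=> z; apply: (@continuous_comp _ _ _ (fun z : R => Num.max z 0)
  (fun z => z ^+ 3)); [exact: continuous_max0|exact: exprn_continuous].
Qed.

(** The lowest point of the path that starts at u with speed - b and then climbs
    with speed a so as to be at x at time t. When it is negative, the optimal
    path from u >= 0 stops at 0 instead. *)
Definition turning_point x t u a b : R := (a * u + b * x - a * b * t) / (a + b).

(** A single expression for the three regions and the two signs of u: in each
    case the terms that do not belong to the region vanish, being cubes of
    positive parts of nonpositive numbers. *)
Definition cost1 x t u a b : R :=
  pcube u / (6 * b) + pcube (- u) / (6 * a) + pcube x / (6 * a)
  + pcube (- x) / (6 * b)
  - (1 / (6 * a) + 1 / (6 * b))
    * (pcube (turning_point x t u a b) + pcube (turning_point (- x) t (- u) b a)).

Lemma cost1N x t u a b : cost1 (- x) t (- u) b a = cost1 x t u a b.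
Proof. by rewrite /cost1 !opprK; ring. Qed.

Definition reach1 x t u a b : Prop := 0 <= t /\ u - b * t <= x <= u + a * t.

Lemma reach1N x t u a b : reach1 x t u a b -> reach1 (- x) t (- u) b a.
Proof. by case=> t0 /andP[? ?]; split=> //; apply/andP; split; lra. Qed.

(** For u >= 0 the mirrored turning point is nonpositive, and the regions are
    told apart by the signs of x and of the turning point, as x lies above
    a t - a u / b exactly when the turning point is nonnegative. *)
Lemma V1_nneg_cost1 x t u a b : 0 < a -> 0 < b -> 0 <= u ->
  reach1 x t u a b -> V1_nneg x t u a b = (cost1 x t u a b)%:E.
Proof.
move=> a0 b0 u0 [t0 /andP[ux xu]].
have ab0 : 0 < a + b by rewrite addr_gt0.
have un : pcube (- u) = 0 by rewrite pcube_npos// oppr_le0.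
have mn : pcube (turning_point (- x) t (- u) b a) = 0.
  rewrite pcube_npos// /turning_point; apply: mulr_le0_ge0; last by rewrite invr_ge0; lra.
  have : 0 <= b * u by rewrite mulr_ge0// ltW.
  have : 0 <= a * (x - u + b * t) by rewrite mulr_ge0 ?(ltW a0)//; lra.
  have : 0 <= a * u by rewrite mulr_ge0// ltW.
  lra.
have num_turn : turning_point x t u a b * (a + b) = a * u + b * x - a * b * t.
  by rewrite /turning_point divfK ?gt_eqF.
have turn_ge0 : (0 <= turning_point x t u a b) = (a * t - a * u / b <= x).
  rewrite -(pmulr_lge0 _ ab0) num_turn.
  rewrite -[RHS]subr_ge0 -[RHS](pmulr_rge0 _ b0).
  by congr (0 <= _); field; rewrite gt_eqF.
rewrite /V1_nneg /cost1 un mn mul0r !addr0.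
case: ifPn => [|nO1].
  rewrite inE => -[_ /= O1]; congr (_%:E).
  have x0 : 0 <= x.
    case: O1 => [[/andP[_ tu] _]|[tu /andP[xt _]]].
      by move: tu; rewrite ltr_pdivlMr// => tu; lra.
    apply: le_trans xt; rewrite subr_ge0.
    by rewrite -mulrA ler_pM2l.
  have m0 : 0 <= turning_point x t u a b.
    case: O1 => [[/andP[_ tu] _]|[tu /andP[xt _]]]; last by rewrite turn_ge0.
    rewrite turn_ge0 (le_trans _ x0)// subr_le0.
    by rewrite -mulrA ler_pM2l// ltW.
  have xn : pcube (- x) = 0 by rewrite pcube_npos// oppr_le0.
  by rewrite (pcube_nneg u0) (pcube_nneg x0) (pcube_nneg m0) xn /turning_point; ring.
have tu : u / b <= t.
  rewrite leNgt; apply: contraNN nO1 => tu; rewrite inE; split => //=.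
  by left; rewrite t0 tu ux xu.
have m0 : turning_point x t u a b < 0.
  rewrite ltNge turn_ge0; apply: contraNN nO1 => tx; rewrite inE; split => //=.
  by right; rewrite tu tx xu.
have xlt : x < a * t - a * u / b by rewrite ltNge -turn_ge0 -ltNge.
rewrite (pcube_npos (ltW m0)).
have [x0|x0] := leP 0 x.
  rewrite ifT; last by rewrite inE; split => //=; rewrite tu x0.
  have xn : pcube (- x) = 0 by rewrite pcube_npos// oppr_le0.
  by congr (_%:E); rewrite (pcube_nneg u0) (pcube_nneg x0) xn; ring.
rewrite ifF; last first.
  by apply/negP; rewrite inE => -[_ /= [_ /andP[]]]; rewrite leNgt x0.
rewrite ifT; last by rewrite inE; split => //=; rewrite tu ux x0.
have xn : 0 <= - x by rewrite oppr_ge0 ltW.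
congr (_%:E); rewrite (pcube_npos (ltW x0)) (pcube_nneg u0) (pcube_nneg xn); ring.
Qed.

Lemma V1_cost1 x t u a b : 0 < a -> 0 < b -> reach1 x t u a b ->
  V1 x t u a b = (cost1 x t u a b)%:E.
Proof.
move=> a0 b0 r; rewrite /V1; case: leP => u0; first exact: V1_nneg_cost1.
rewrite -cost1N V1_nneg_cost1//; first by rewrite oppr_ge0 ltW.
exact: reach1N.
Qed.

Lemma turning_pointN_le x t u a b : 0 < a -> 0 < b -> x <= u + a * t ->
  turning_point (- x) t (- u) b a <= - x.
Proof.
move=> a0 b0 xu; rewrite /turning_point ler_pdivrMr ?addr_gt0//.
have : 0 <= b * (u + a * t - x) by rewrite mulr_ge0 ?subr_ge0// ltW.
lra.
Qed.

(** A step of length h at speed a leaves the turning point unchanged and raises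
    the mirrored one by h a. The first correction is the integral of half the
    square of the position along the step; the second one is nonnegative by
    [pcube_increment] and [turning_pointN_le]. *)
Lemma cost1_step x t u a b h : 0 < a -> 0 < b ->
  let m := turning_point (- x) t (- u) b a in
  cost1 x t u a b = cost1 (x - h * a) (t - h) u a b
    + (x ^+ 3 - (x - h * a) ^+ 3) / (6 * a)
    - (1 / (6 * a) + 1 / (6 * b))
      * ((pcube (- x + h * a) - pcube (- x)) - (pcube (m + h * a) - pcube m)).
Proof.
move=> a0 b0 m.
have ab0 : a + b != 0 by rewrite gt_eqF ?addr_gt0.
have t1 : turning_point (x - h * a) (t - h) u a b = turning_point x t u a b.
  by rewrite /turning_point; congr (_ / _); ring.
have t2 : turning_point (- (x - h * a)) (t - h) (- u) b a = m + h * a.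
  by rewrite /m /turning_point; field; rewrite addrC.
rewrite /cost1 t1 t2 -/m -!pcubeBN !opprB.
rewrite [h * a - x]addrC.
move: (6 * a) (6 * b) => A B; ring.
Qed.

Lemma cube_increment_bound x v h : 0 < v -> 0 <= h <= 1 ->
  `|(x ^+ 3 - (x - h * v) ^+ 3) / (6 * v) - h * (x ^+ 2 / 2)|
    <= (`|x| + v) * v * h ^+ 2.
Proof.
move=> v0 /andP[h0 h1].
have -> : (x ^+ 3 - (x - h * v) ^+ 3) / (6 * v) - h * (x ^+ 2 / 2)
    = h ^+ 2 * (v / 6) * (h * v - 3 * x).
  by field; rewrite gt_eqF.
have k0 : 0 <= h ^+ 2 * (v / 6).
  by rewrite mulr_ge0 ?sqr_ge0// divr_ge0// ltW.
rewrite normrM (ger0_norm k0).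
apply: (@le_trans _ _ (h ^+ 2 * (v / 6) * (6 * (`|x| + v)))); last first.
  by rewrite le_eqVlt; apply/orP; left; apply/eqP; field.
rewrite ler_wpM2l//; apply: le_trans (ler_normB _ _) _.
have hv0 : 0 <= h * v by rewrite mulr_ge0// ltW.
rewrite (ger0_norm hv0) normrM (ger0_norm (_ : 0 <= 3))//.
have : 0 <= (1 - h) * v by rewrite mulr_ge0 ?subr_ge0// ltW.
have := normr_ge0 x; lra.
Qed.

Lemma cost1_step_le x t u a b h : 0 < a -> 0 < b -> 0 <= h <= 1 ->
  x <= u + a * t ->
  cost1 x t u a b <= cost1 (x - h * a) (t - h) u a b + h * (x ^+ 2 / 2)
    + (`|x| + a) * a * h ^+ 2.
Proof.
move=> a0 b0 h01 xu; have /andP[h0 h1] := h01.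
rewrite (cost1_step x t u h a0 b0)/=; set m := turning_point (- x) _ _ _ _.
have ha0 : 0 <= h * a by rewrite mulr_ge0// ltW.
have := pcube_increment ha0 (turning_pointN_le a0 b0 xu).
rewrite -/m -subr_ge0.
set c := 1 / _ + _; have c0 : 0 <= c.
  by rewrite /c addr_ge0// divr_ge0// mulr_ge0// ltW.
move=> /(mulr_ge0 c0).
have := cube_increment_bound x a0 h01; rewrite ler_norml => /andP[_].
move: (c * _) (_ / _) (cost1 _ _ _ _ _) => k1 k2 k3; lra.
Qed.

(** The last correction in [cost1_step] vanishes on the edge x = u + a t of the
    cone, where the mirrored turning point is - x, and it is at most of order
    h^3 if x >= 0, where only cubes of numbers below h a are involved. *)
Lemma cost1_step_ge x t u a b : 0 < a -> 0 < b -> x <= u + a * t ->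
  0 <= x \/ x = u + a * t ->
  exists C, forall h, 0 <= h <= 1 ->
  cost1 (x - h * a) (t - h) u a b + h * (x ^+ 2 / 2)
    <= cost1 x t u a b + C * h ^+ 2.
Proof.
move=> a0 b0 xu xcase.
set c := 1 / (6 * a) + 1 / (6 * b); have c0 : 0 <= c.
  by rewrite /c addr_ge0// divr_ge0// mulr_ge0// ltW.
exists ((`|x| + a) * a + c * a ^+ 3) => h h01; have /andP[h0 h1] := h01.
rewrite (cost1_step x t u h a0 b0)/= -/c; set m := turning_point (- x) _ _ _ _.
have ha0 : 0 <= h * a by rewrite mulr_ge0// ltW.
set D := (_ - _ - (_ - _)).
have Dle : D <= h ^+ 2 * a ^+ 3.
  apply: (@le_trans _ _ (pcube (h * a))); last first.
    rewrite pcube_nneg// exprMn; apply: ler_wpM2r.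
      by rewrite exprn_ge0// ltW.
    by rewrite exprS ler_piMl// sqr_ge0.
  rewrite /D; case: xcase => [x0|xE].
    rewrite [pcube (- x)]pcube_npos ?oppr_le0// subr0.
    have : pcube (- x + h * a) <= pcube (h * a) by apply: pcube_le; lra.
    have : pcube m <= pcube (m + h * a) by apply: pcube_le; lra.
    lra.
  have -> : m = - x.
    by rewrite /m /turning_point xE; field; rewrite gt_eqF// addr_gt0.
  by rewrite subrr pcube_ge0.
have cD : c * D <= c * (h ^+ 2 * a ^+ 3) by rewrite ler_wpM2l.
have := cube_increment_bound x a0 h01; rewrite ler_norml => /andP[+ _].
move: (c * D) cD (_ / _) (cost1 _ _ _ _ _) => k1 cD k2 k3; lra.
Qed.

Definition extreme_speed a b v : Prop := v = a \/ v = - b.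

Lemma cost1_dynamic_le x t u a b v h : 0 < a -> 0 < b ->
  extreme_speed a b v -> 0 <= h <= 1 -> reach1 x t u a b ->
  cost1 x t u a b <= cost1 (x - h * v) (t - h) u a b + h * (x ^+ 2 / 2)
    + (`|x| + `|v|) * `|v| * h ^+ 2.
Proof.
move=> a0 b0 ev h01 [t0 /andP[ux xu]].
case: ev => ->; first by rewrite (gtr0_norm a0); exact: cost1_step_le.
rewrite normrN (gtr0_norm b0) -(normrN x) -(sqrrN x) -[cost1 x _ _ _ _]cost1N.
rewrite -[cost1 (x - _) _ _ _ _]cost1N mulrN opprK opprD.
by apply: cost1_step_le => //; lra.
Qed.

Lemma reach1_forward x t u a b v h : 0 < a -> 0 < b ->
  extreme_speed a b v -> 0 <= h -> reach1 (x - h * v) (t - h) u a b ->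
  reach1 x t u a b.
Proof.
move=> a0 b0 ev h0 [th /andP[l r]].
have ha : 0 <= h * a by rewrite mulr_ge0// ltW.
have hb : 0 <= h * b by rewrite mulr_ge0// ltW.
by split; [lra|case: ev => vE; rewrite vE in l r; apply/andP; split; lra].
Qed.

Lemma near0_right_le (e : R) : 0 < e -> \forall h \near (0 : R)^'+, 0 <= h <= e.
Proof.
move=> e0; apply: filterS2 (nbhs_right_gt 0) (nbhs_right_le e0) => h h0 he.
by rewrite ltW.
Qed.

(** For x >= 0 the optimal final speed is a, unless x lies on the edge
    x = u - b t, which can only be reached with speed - b. *)
Lemma cost1_dynamic_ge_pos x t u a b : 0 < a -> 0 < b -> 0 < t ->
  reach1 x t u a b -> 0 <= x ->
  exists2 v, extreme_speed a b v & exists C, \forall h \near (0 : R)^'+,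
    reach1 (x - h * v) (t - h) u a b /\
    cost1 (x - h * v) (t - h) u a b + h * (x ^+ 2 / 2)
      <= cost1 x t u a b + C * h ^+ 2.
Proof.
move=> a0 b0 t0 [_ /andP[ux xu]] x0.
have t1 : 0 < Num.min 1 t by rewrite lt_min ltr01.
move: ux; rewrite le_eqVlt => /predU1P[ux|ux].
  exists (- b); first by right.
  have [C HC] : exists C, forall h, 0 <= h <= 1 ->
      cost1 (- x - h * b) (t - h) (- u) b a + h * ((- x) ^+ 2 / 2)
      <= cost1 (- x) t (- u) b a + C * h ^+ 2.
    by apply: cost1_step_ge => //; [lra|right; lra].
  exists C; apply: filterS (near0_right_le t1) => h /andP[h0].
  rewrite le_min => /andP[h1 ht]; split.
    split; first by rewrite subr_ge0.
    have : 0 <= (a + b) * (t - h) by rewrite mulr_ge0 ?subr_ge0// addr_ge0// ltW.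
    by rewrite -ux => ?; apply/andP; split; lra.
  have := HC h; rewrite h0 h1 => /(_ isT).
  by rewrite cost1N -[cost1 (x - _) _ _ _ _]cost1N sqrrN mulrN opprK opprD.
exists a; first by left.
have [C HC] := cost1_step_ge a0 b0 xu (or_introl x0).
exists C; have e0 : 0 < (x - u + b * t) / (a + b).
  by rewrite divr_gt0//; lra.
apply: filterS2 (near0_right_le t1) (near0_right_le e0) => h /andP[h0].
rewrite le_min => /andP[h1 ht] /andP[_ he]; split; last by apply: HC; rewrite h0.
split; first by rewrite subr_ge0.
move: he; rewrite ler_pdivlMr ?addr_gt0// => he.
by apply/andP; split; lra.
Qed.

Lemma cost1_dynamic_ge x t u a b : 0 < a -> 0 < b -> 0 < t ->
  reach1 x t u a b ->
  exists2 v, extreme_speed a b v & exists C, \forall h \near (0 : R)^'+,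
    reach1 (x - h * v) (t - h) u a b /\
    cost1 (x - h * v) (t - h) u a b + h * (x ^+ 2 / 2)
      <= cost1 x t u a b + C * h ^+ 2.
Proof.
move=> a0 b0 t0 r; have [x0|/ltW x0] := leP 0 x; first exact: cost1_dynamic_ge_pos.
have [|v ev [C HC]] := cost1_dynamic_ge_pos b0 a0 t0 (reach1N r).
  by rewrite oppr_ge0.
exists (- v); first by case: ev => ->; [right|left; rewrite opprK].
exists C; apply: filterS HC => h [/reach1N r' c']; split.
  have E : - (- x - h * v) = x - h * - v by ring.
  by move: r'; rewrite E opprK.
move: c'; rewrite cost1N sqrrN -[cost1 (x - _) _ _ _ _]cost1N.
by rewrite mulrN opprK opprD.
Qed.

Lemma continuous_cost1 a b (T : topologicalType) (fx ft fu : T -> R) :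
  continuous fx -> continuous ft -> continuous fu ->
  continuous (fun q => cost1 (fx q) (ft q) (fu q) a b).
Proof.
move=> cx ct cu q.
have cP (g : T -> R) (l : R) : g @ q --> l -> (fun q => pcube (g q)) @ q --> pcube l.
  by move=> cg; apply: cvg_comp cg _; exact: continuous_pcube.
have cM (k : R) (g : T -> R) (l : R) : g @ q --> l -> (fun q => k * g q) @ q --> k * l.
  by move=> cg; apply: cvgM => //; exact: cvg_cst.
have cV (k : R) (g : T -> R) (l : R) : g @ q --> l -> (fun q => g q / k) @ q --> l / k.
  by move=> cg; apply: cvgM => //; exact: cvg_cst.
have cN (g : T -> R) (l : R) : g @ q --> l -> (fun q => - g q) @ q --> - l.
  by move=> cg; exact: cvgN.
rewrite /cost1 /turning_point; apply: cvgB.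
  apply: cvgD; [apply: cvgD; [apply: cvgD|]|]; apply: (cV); apply: (cP).
  - exact: cu.
  - by apply: (cN); exact: cu.
  - exact: cx.
  - by apply: (cN); exact: cx.
apply: (cM); apply: cvgD; apply: (cP); apply: (cV);
  (apply: cvgB; last by apply: (cM); exact: ct); apply: cvgD; apply: (cM).
- exact: cu.
- exact: cx.
- by apply: (cN); exact: cu.
- by apply: (cN); exact: cx.
Qed.

End OneDimensionalFormula.

(** * The Hamiltonian as a support function *)

Section ConvexHull.
Context {R : realType} {n : nat}.
Local Notation X := 'cV[R]_n.

Lemma convex_set_conv (C : set X) (x y : X) (s : R) :
  @convex_set R X C -> 0 <= s <= 1 -> C x -> C y -> C (s *: x + (1 - s) *: y).
Proof.
move=> cC /andP[s0 s1] Cx Cy.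
by have := cC x y (Itv01 s0 s1) (mem_set Cx) (mem_set Cy); rewrite inE.
Qed.

(** Since 0 belongs to the set, the weights need not add up to 1. By induction a
    sum of weighted points is the total weight times a point of the set. *)
Lemma convex_set_sum (C : set X) (I : Type) (r : seq I) (l : I -> R) (e : I -> X) :
  @convex_set R X C -> C 0 -> (forall i, 0 <= l i) -> (forall i, C (e i)) ->
  \sum_(i <- r) l i <= 1 -> C (\sum_(i <- r) l i *: e i).
Proof.
move=> cC C0 l0 Ce.
have [y Cy ->] : exists2 y, C y &
    \sum_(i <- r) l i *: e i = (\sum_(i <- r) l i) *: y.
  elim: r => [|i r [y Cy IH]]; first by exists 0 => //; rewrite !big_nil scale0r.
  rewrite !big_cons IH; set S := \sum_(j <- r) _.
  have S0 : 0 <= S by exact: sumr_ge0.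
  have [lS|lS] := eqVneq (l i + S) 0.
    have [-> ->] : l i = 0 /\ S = 0 by have := l0 i; split; lra.
    by exists 0 => //; rewrite addr0 !scale0r addr0.
  have lS0 : 0 < l i + S by rewrite lt_neqAle eq_sym lS addr_ge0.
  exists ((l i / (l i + S)) *: e i + (1 - l i / (l i + S)) *: y).
    apply: convex_set_conv => //; apply/andP; split.
      by rewrite divr_ge0// ltW.
    by rewrite ler_pdivrMr// mul1r lerDl.
  rewrite scalerDr !scalerA; congr (_ *: _ + _ *: _); by field.
set S := \sum_(i <- r) l i => S1.
suff : C (S *: y + (1 - S) *: 0) by rewrite scaler0 addr0.
by apply: convex_set_conv => //; rewrite S1 sumr_ge0.
Qed.

Lemma conv_hull_sub (E : set X) : E `<=` conv_hull E.
Proof. exact: sub_gen_smallest. Qed.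

Lemma conv_hull_min (E C : set X) : @convex_set R X C -> E `<=` C -> conv_hull E `<=` C.
Proof. exact: smallest_sub. Qed.

Lemma convex_conv_hull (E : set X) : @convex_set R X (conv_hull E).
Proof.
move=> x y l; rewrite !inE => Ex Ey C [cC EC].
have Cx := mem_set (Ex C (conj cC EC)); have Cy := mem_set (Ey C (conj cC EC)).
by have := cC x y l Cx Cy; rewrite inE.
Qed.

End ConvexHull.

Section SupportFunction.
Context {R : realType} {n : nat}.
Local Notation X := 'cV[R]_n.
Variables (P : 'M[R]_n) (a b : 'I_n -> R).
Hypothesis P_unit : P \in unitmx.
Hypothesis a_gt0 : forall i, 0 < a i.
Hypothesis b_gt0 : forall i, 0 < b i.

Definition slope1 (i : 'I_n) (q : R) : R := Num.max (a i * q) (- b i * q).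

(** The support function of the box of velocities, written in the basis formed
    by the columns of P. *)
Definition support_fun (p : X) : R := \sum_i slope1 i ((invmx P *m p) i 0).

Lemma slope1_ge0 i q : 0 <= slope1 i q.
Proof.
rewrite /slope1 le_max; have [q0|/ltW q0] := leP 0 q; apply/orP.
  by left; rewrite mulr_ge0// ltW.
by right; rewrite mulNr oppr_ge0 pmulr_rle0.
Qed.

Lemma slope1D i q r : slope1 i (q + r) <= slope1 i q + slope1 i r.
Proof. by rewrite /slope1 ge_max !mulrDr !lerD// le_max lexx ?orbT. Qed.

Lemma slope1Z i c q : 0 <= c -> slope1 i (c * q) = c * slope1 i q.
Proof. by move=> c0; rewrite /slope1 maxr_pMr// !mulrA ![c * _]mulrC. Qed.

Lemma slope1_speed i v q : extreme_speed (a i) (b i) v -> v * q <= slope1 i q.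
Proof. by case=> ->; rewrite /slope1 le_max lexx ?orbT. Qed.

Lemma slope1_attained i q : exists2 v, extreme_speed (a i) (b i) v & v * q = slope1 i q.
Proof.
rewrite /slope1; case: (leP (a i * q)) => _; first by exists (- b i) => //; right.
by exists (a i) => //; left.
Qed.

Lemma slope1_le_norm i q : slope1 i q <= (a i + b i) * `|q|.
Proof.
have qn := ler_norm q; have qn' := ler_norm (- q); rewrite normrN in qn'.
have ha : 0 <= a i * (`|q| - q) by rewrite mulr_ge0 ?subr_ge0// ltW.
have hb : 0 <= b i * (`|q| + q) by rewrite mulr_ge0 ?(ltW (b_gt0 i))//; lra.
have ha' : 0 <= a i * `|q| by rewrite mulr_ge0// ltW.
have hb' : 0 <= b i * `|q| by rewrite mulr_ge0// ltW.
by rewrite /slope1 ge_max; apply/andP; split; lra.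
Qed.

Lemma support_fun_ge0 p : 0 <= support_fun p.
Proof. by apply: sumr_ge0 => i _; exact: slope1_ge0. Qed.

Lemma support_funD p q : support_fun (p + q) <= support_fun p + support_fun q.
Proof.
rewrite -big_split; apply: ler_sum => i _ /=.
by rewrite mulmxDr mxE; exact: slope1D.
Qed.

Lemma support_funZ c p : 0 <= c -> support_fun (c *: p) = c * support_fun p.
Proof.
move=> c0; rewrite mulr_sumr; apply: eq_bigr => i _.
by rewrite -scalemxAr mxE slope1Z.
Qed.

(** The constant of a linear bound of [support_fun] in the l^1 norm. *)
Definition support_lip : R := \sum_i (a i + b i) * \sum_j `|invmx P i j|.

Lemma support_lip_ge0 : 0 <= support_lip.
Proof.
apply: sumr_ge0 => i _; rewrite mulr_ge0 ?sumr_ge0//.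
by rewrite addr_ge0// ltW.
Qed.

Lemma support_fun_bound p : support_fun p <= support_lip * \sum_i `|p i 0|.
Proof.
rewrite mulr_suml; apply: ler_sum => i _.
apply: le_trans (slope1_le_norm _ _) _; rewrite -mulrA ler_wpM2l//.
  by rewrite addr_ge0// ltW.
rewrite mxE mulr_suml; apply: le_trans (ler_norm_sum _ _ _) _.
apply: ler_sum => j _; rewrite normrM ler_wpM2l//.
by rewrite (bigD1 j)//= lerDl sumr_ge0.
Qed.

Definition extreme_velocity (v : X) : Prop :=
  forall i, extreme_speed (a i) (b i) ((P^T *m v) i 0).

Lemma inner_change_basis v p : inner v p = inner (P^T *m v) (invmx P *m p).
Proof. by rewrite -inner_mulmx mulKVmx. Qed.

Lemma extreme_velocity_le v p : extreme_velocity v -> inner v p <= support_fun p.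
Proof.
by move=> vV; rewrite inner_change_basis; apply: ler_sum => i _; exact: slope1_speed.
Qed.

Lemma extreme_velocity_attained p :
  exists2 v, extreme_velocity v & inner v p = support_fun p.
Proof.
have /choice[w Hw] i : exists v, extreme_speed (a i) (b i) v /\
    v * (invmx P *m p) i 0 = slope1 i ((invmx P *m p) i 0).
  by have [v ? ?] := slope1_attained i ((invmx P *m p) i 0); exists v.
have PT_unit : P^T \in unitmx by rewrite unitmx_tr.
exists (invmx P^T *m \col_i w i).
  by move=> i; rewrite mulKVmx// mxE; have [] := Hw i.
rewrite inner_change_basis mulKVmx//; apply: eq_bigr => i _.
by rewrite mxE; have [] := Hw i.
Qed.

End SupportFunction.

Section UnitBall.
Context {R : realType} {n : nat}.
Local Notation X := 'cV[R]_n.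
Variables (u : 'I_n -> X) (a b : 'I_n -> R).
Hypothesis a_gt0 : forall i, 0 < a i.
Hypothesis b_gt0 : forall i, 0 < b i.
Let P : 'M[R]_n := \matrix_(i < n, j < n) u j i 0.

Lemma columns_mulmx (c : X) : P *m c = \sum_j c j 0 *: u j.
Proof.
apply/colP => i; rewrite mxE summxE; apply: eq_bigr => j _.
by rewrite !mxE mulrC.
Qed.

Lemma columns_unitmx : free [seq u j | j : 'I_n] -> P \in unitmx.
Proof.
move=> uf; rewrite -unitmx_tr unitmxE unitfE; apply/negP => /det0P[v v0 vP].
have {}uf : free [tuple u j | j < n] by [].
case/negP: v0; apply/eqP/rowP => j; rewrite mxE.
apply: (elimT freeP uf (fun j => v 0 j)).
transitivity (P *m v^T); last by rewrite -[P]trmxK -trmx_mul vP trmx0.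
rewrite columns_mulmx; apply: eq_bigr => i _.
by rewrite mxE -tnth_nth tnth_mktuple.
Qed.

Hypothesis P_unit : P \in unitmx.

Lemma invmx_column j : invmx P *m u j = delta_mx j 0.
Proof.
have -> : u j = P *m delta_mx j 0.
  rewrite columns_mulmx (bigD1 j)//= mxE !eqxx scale1r big1 ?addr0// => k kj.
  by rewrite mxE (negPf kj) scale0r.
by rewrite mulKmx.
Qed.

Lemma support_fun_column j c : support_fun P a b (c *: u j) = slope1 a b j c.
Proof.
rewrite /support_fun (bigD1 j)//= -scalemxAr invmx_column big1 ?addr0.
  by rewrite !mxE !eqxx mulr1.
by move=> i /negPf ij; rewrite !mxE ij mulr0 /slope1 !mulr0 maxxx.
Qed.

(** Positively 1-homogeneous nonnegative functions with the same unit ball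
    coincide. The ball of [support_fun] is the hull because
    p = sum_j q_j u_j is the combination of the vertices u_j / a_j and
    - u_j / b_j selected by the signs of the q_j with weights
    [slope1 j q_j], whose sum is [support_fun p]; the weight left over goes to
    0, which lies in the hull as K 0 = 0. *)
Lemma gauge_unique (K : X -> R) :
  (forall x, 0 <= K x) -> homogeneous1 K ->
  [set x | K x <= 1] =
     conv_hull (\bigcup_j [set (1 / a j) *: u j; - ((1 / b j) *: u j)]) ->
  K =1 support_fun P a b.
Proof.
move=> K0 Khom Kball.
set E := \bigcup_j _ in Kball.
have ball p : K p <= 1 <-> support_fun P a b p <= 1.
  have -> : (K p <= 1 : Prop) = conv_hull E p by rewrite -Kball.
  split.
    apply: (@conv_hull_min R n E [set x | support_fun P a b x <= 1]).
      move=> x y l; rewrite !inE /= => Kx Ky.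
      apply: le_trans (support_funD _ _ _ _ _) _.
      have l1' : 0 <= unstable.onem l%:num by rewrite subr_ge0.
      rewrite !support_funZ//.
      have l0 : 0 <= l%:num by [].
      have l1 : l%:num <= 1 by [].
      have : 0 <= l%:num * (1 - support_fun P a b x) by rewrite mulr_ge0 ?subr_ge0.
      have : 0 <= (1 - l%:num) * (1 - support_fun P a b y).
        by rewrite mulr_ge0 ?subr_ge0.
      rewrite /unstable.onem; lra.
    move=> _ [j _ [->|->]] /=.
      rewrite support_fun_column /slope1 mul1r mulfV ?gt_eqF// ge_max lexx/=.
      by rewrite mulNr lerNl (le_trans (lerN10 _))// divr_ge0// ltW.
    rewrite -scaleNr support_fun_column /slope1 mul1r mulrNN mulfV ?gt_eqF//.
    by rewrite ge_max lexx andbT mulrN lerNl (le_trans (lerN10 _))// divr_ge0// ltW.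
  move=> p1; have cE := convex_conv_hull (E := E).
  (* K (2 * 0) = 2 K 0 gives K 0 = 0. *)
  have C0 : conv_hull E 0.
    rewrite -Kball /=; have := Khom 2 0 ltac:(lra); rewrite scaler0; lra.
  pose q := invmx P *m p.
  pose e j := if 0 <= q j 0 then (1 / a j) *: u j else - ((1 / b j) *: u j).
  have -> : p = \sum_j slope1 a b j (q j 0) *: e j.
    rewrite -[p in LHS](mulKVmx P_unit) -/q columns_mulmx; apply: eq_bigr => j _.
    rewrite /e /slope1; case: leP => q0.
      rewrite max_l ?scalerA; last first.
        rewrite mulNr; apply: (@le_trans _ _ 0).
          by rewrite oppr_le0 mulr_ge0// ltW.
        by rewrite mulr_ge0// ltW.
      by congr (_ *: _); field; rewrite gt_eqF.
    rewrite max_r ?scalerN ?scalerA -1?scaleNr; last first.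
      apply: (@le_trans _ _ 0); first by rewrite pmulr_rle0// ltW.
      by rewrite mulNr oppr_ge0 pmulr_rle0// ltW.
    by congr (_ *: _); field; rewrite gt_eqF.
  apply: convex_set_sum => // j; first exact: slope1_ge0.
  by apply: conv_hull_sub; exists j => //; rewrite /e; case: ifP => _; [left|right].
have le_iff p c : 0 < c -> (K p <= c) = (support_fun P a b p <= c).
  move=> c0; have cV : 0 < c^-1 by rewrite invr_gt0.
  have := ball (c^-1 *: p).
  rewrite Khom// support_funZ ?(ltW cV)// !ler_pdivrMl// !mulr1 => -[h1 h2].
  by apply/idP/idP.
move=> p; apply/eqP; rewrite eq_le; apply/andP; split; apply/ler_addgt0Pr => e e0.
- by rewrite le_iff ?lerDl ?ltW// ltr_wpDl// support_fun_ge0.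
- by rewrite -le_iff ?lerDl ?ltW// ltr_wpDl.
Qed.

End UnitBall.

(** * The value function *)

Section CompactMinimum.
Context {R : realType}.

Lemma continuous_compact_min (U T : topologicalType) (G : U * T -> R)
    (A : set T) (m : U -> R) :
  compact A -> continuous G ->
  (forall x, exists2 th, A th & m x = G (x, th)) ->
  (forall x th, A th -> m x <= G (x, th)) -> continuous m.
Proof.
move=> cA cG mE mle x0; apply/cvgrPdist_lt => e e0.
have near_x := near_compact_uniform cA (fun th _ => cG (x0, th)) e0.
apply: filterS near_x => x Hx.
have [th Ath mth] := mE x; have [th0 Ath0 mth0] := mE x0.
have := Hx _ Ath; have := Hx _ Ath0.
have := mle x _ Ath0; have := mle x0 _ Ath.
rewrite mth mth0 !ltr_norml => ? ? /andP[? ?] /andP[? ?].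
by apply/andP; split; lra.
Qed.

End CompactMinimum.

Section ValueFunction.
Context {R : realType} {n : nat}.
Local Notation X := 'cV[R]_n.
Variables (P : 'M[R]_n) (a b : 'I_n -> R) (v0 : X) (Phi : X -> R).
Hypothesis P_unit : P \in unitmx.
Hypothesis a_gt0 : forall i, 0 < a i.
Hypothesis b_gt0 : forall i, 0 < b i.
Hypothesis Phi_cont : continuous Phi.

Definition coords (x : X) : X := P^T *m x - P^T *m v0.

Definition total_cost (x : X) (t : R) (w : X) : R :=
  \sum_i cost1 (coords x i 0) t (w i 0) (a i) (b i)
  + Phi (invmx P^T *m w + v0).

Definition reachable (x : X) (t : R) (w : X) : Prop :=
  forall i, reach1 (coords x i 0) t (w i 0) (a i) (b i).

Lemma reachableE x t w : 0 <= t ->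
  reachable x t w <->
  forall i, coords x i 0 - a i * t <= w i 0 <= coords x i 0 + b i * t.
Proof.
move=> t0; split=> r i; have := r i.
  by case=> _ /andP[? ?]; apply/andP; split; lra.
by move=> /andP[? ?]; split=> //; apply/andP; split; lra.
Qed.

Lemma valueE_term x t w : reachable x t w ->
  (\sum_(i < n) V1 (coords x i 0%R) t (w i 0%R) (a i) (b i)
   + (Phi (invmx P^T *m w + v0)%R)%:E)%E = (total_cost x t w)%:E.
Proof.
move=> r; rewrite /total_cost EFinD -sumEFin; congr (_ + _)%E.
by apply: eq_bigr => i _; rewrite V1_cost1.
Qed.

Let Theta : set X := [set th : X | forall i, - a i <= th i 0 <= b i].

(** The admissible w move with (x, t); this parametrization by a fixed box makes
    them range over a fixed compact set. Clamping t makes everything continuous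
    on the whole space. *)
Let target (p : X * R) (th : X) : X := coords p.1 + Num.max p.2 0 *: th.

Let G (q : X * R * X) : R :=
  total_cost q.1.1 (Num.max q.1.2 0) (target q.1 q.2).

Let reachable_target p th : Theta th -> reachable p.1 (Num.max p.2 0) (target p th).
Proof.
move=> Ath; have m0 : 0 <= Num.max p.2 0 by rewrite le_max lexx orbT.
apply/reachableE => // i; rewrite !mxE; set m := Num.max _ _ in m0 *.
have /andP[l r] := Ath i.
have : 0 <= m * (th i 0 + a i) by rewrite mulr_ge0//; lra.
have : 0 <= m * (b i - th i 0) by rewrite mulr_ge0//; lra.
by move=> ? ?; apply/andP; split; lra.
Qed.

Let target_surj p w : reachable p.1 (Num.max p.2 0) w ->
  exists2 th, Theta th & w = target p th.
Proof.
move=> r; have m0 : 0 <= Num.max p.2 0 by rewrite le_max lexx orbT.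
move/(reachableE _ _ m0) : r; rewrite /target; set m := Num.max _ _ in m0 *.
move: m0; rewrite le_eqVlt => /predU1P[<-|m0] r.
  exists 0 => [i|].
    by rewrite mxE oppr_le0 !ltW.
  apply/colP => i; rewrite scale0r addr0; apply/eqP; rewrite eq_le andbC.
  by have := r i; rewrite !mulr0 subr0 addr0.
exists (m^-1 *: (w - coords p.1)) => [i|].
  rewrite mxE [X in _ * X]mxE [X in _ + X]mxE mulrC ler_pdivrMr// ler_pdivlMr//.
  by have /andP[? ?] := r i; apply/andP; split; lra.
by rewrite scalerA mulfV ?gt_eqF// scale1r addrC subrK.
Qed.

Let continuous_mulmx m (A : 'M[R]_(m, n)) : continuous (fun x : X => A *m x).
Proof.
move=> x; apply: (@cV_cvgP R m _ (nbhs x)) => i.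
rewrite mxE; under eq_fun do rewrite mxE.
apply: cvgr_sum => j; apply: cvgM; first exact: cvg_cst.
exact: coord_continuous.
Qed.

Let continuous_coords : continuous coords.
Proof.
move=> x; apply: (@cvgB _ _ _ (nbhs x) (nbhs_filter x)); last exact: cvg_cst.
exact: (@continuous_mulmx _ P^T x).
Qed.

Let compact_Theta : compact Theta.
Proof. exact: cV_box_compact. Qed.

Let Theta0 : Theta 0.
Proof. by move=> i; rewrite mxE oppr_le0 !ltW. Qed.

Let comp_cts (T U V : topologicalType) (f : T -> U) (g : U -> V) :
  continuous f -> continuous g -> continuous (fun x => g (f x)).
Proof. by move=> cf cg x; apply: continuous_comp; [exact: cf|exact: cg]. Qed.

Let continuous_G : continuous G.
Proof.
have c1 : continuous (fun q : X * R * X => q.1) by move=> q; exact: cvg_fst.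
have c2 : continuous (fun q : X * R * X => q.2) by move=> q; exact: cvg_snd.
have c11 : continuous (fun q : X * R * X => q.1.1).
  by apply: (comp_cts c1) => q; exact: cvg_fst.
have c12 : continuous (fun q : X * R * X => q.1.2).
  by apply: (comp_cts c1) => q; exact: cvg_snd.
have cy := comp_cts c11 continuous_coords.
have ct := comp_cts c12 (@continuous_max0 R).
have cw : continuous (fun q : X * R * X => target q.1 q.2).
  by move=> q; apply: cvgD; [exact: cy|apply: cvgZ; [exact: ct|exact: c2]].
have ccoord i : continuous (fun x : X => x i 0) by exact: coord_continuous.
move=> q; apply: cvgD.
  apply: cvgr_sum => i.
  exact: (continuous_cost1 (a := a i) (b := b i) (comp_cts cy (ccoord i)) ct
    (comp_cts cw (ccoord i)) (x := q)).
have cw' : continuous (fun q : X * R * X => invmx P^T *m target q.1 q.2 + v0).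
  move=> q'; apply: cvgD; last exact: cvg_cst.
  exact: (comp_cts cw (@continuous_mulmx _ (invmx P^T))).
exact: (comp_cts cw' Phi_cont).
Qed.

Let W := value P a b v0 Phi.

Lemma valueE_attained x t : 0 <= t ->
  exists w, [/\ reachable x t w, valueE P a b v0 Phi x t = (total_cost x t w)%:E &
    forall w', reachable x t w' -> total_cost x t w <= total_cost x t w'].
Proof.
move=> t0; have mt : Num.max t 0 = t by rewrite max_l.
have cGx : continuous (fun th => G ((x, t), th)).
  have cpair : continuous (fun th : X => ((x, t), th)).
    move=> th; apply: (@cvg_pair _ _ _ (nbhs th) (nbhs (x, t)) (nbhs th)).
    - exact: cvg_cst.
    - exact: cvg_id.
  exact: (comp_cts cpair continuous_G).
have A0 : Theta !=set0 by exists 0; exact: Theta0.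
have [th /set_mem Ath thmin] :=
  compact_EVT_min A0 compact_Theta (continuous_subspaceT cGx).
have r := @reachable_target (x, t) th Ath; rewrite /= mt in r.
set w := target _ _ in r.
have wmin w' : reachable x t w' -> total_cost x t w <= total_cost x t w'.
  move=> r'; have [|th' Ath' ->] := @target_surj (x, t) w'; first by rewrite /= mt.
  by have := thmin _ (mem_set Ath'); rewrite /G /= mt.
exists w; split=> //; rewrite /valueE; apply/eqP; rewrite eq_le; apply/andP; split.
  apply: ereal_inf_lbound; exists w; first exact/reachableE.
  exact: valueE_term.
apply: le_ereal_inf_tmp => _ [w' /= w'B <-].
have r' : reachable x t w' by exact/reachableE.
by rewrite [leRHS](valueE_term r') lee_fin; exact: wmin.
Qed.

Lemma valueE_fine x t : 0 <= t -> valueE P a b v0 Phi x t = (W (x, t))%:E.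
Proof. by move=> t0; rewrite /W /value; have [w [_ -> _]] := valueE_attained x t0. Qed.

Lemma value_attained x t : 0 <= t ->
  exists2 w, reachable x t w & W (x, t) = total_cost x t w.
Proof.
move=> t0; have [w [r E _]] := valueE_attained x t0.
by exists w => //; rewrite /W /value/= E.
Qed.

Lemma value_le x t w : reachable x t w -> 0 <= t -> W (x, t) <= total_cost x t w.
Proof.
move=> r t0; have [w0 [r0 E mn]] := valueE_attained x t0.
by rewrite /W /value/= E; exact: mn.
Qed.

Lemma continuous_value : continuous (fun p : X * R => W (p.1, Num.max p.2 0)).
Proof.
apply: (continuous_compact_min compact_Theta continuous_G) => [p|p th Ath].
  have m0 : 0 <= Num.max p.2 0 by rewrite le_max lexx orbT.
  have [w r E] := value_attained p.1 m0.
  by have [th Ath wE] := target_surj r; exists th => //; rewrite E wE.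
apply: value_le; first exact: reachable_target.
by rewrite le_max lexx orbT.
Qed.

Lemma value_initial x : W (x, 0) = Phi x.
Proof.
have [w r ->] := value_attained x (lexx 0).
(* At time 0 the box of admissible w is the single point coords x. *)
have wE : w = coords x.
  apply/colP => i; apply/eqP; rewrite eq_le andbC.
  by move/(reachableE _ _ (lexx 0)): r => /(_ i); rewrite !mulr0 subr0 addr0.
rewrite /total_cost; have -> : invmx P^T *m w + v0 = x.
  by rewrite wE /coords -mulmxBr mulKmx ?subrK// unitmx_tr.
rewrite big1 ?add0r// => i _; rewrite wE /cost1 /turning_point !mulr0 !subr0.
have Ea : (a i * coords x i 0 + b i * coords x i 0) / (a i + b i) = coords x i 0.
  by field; rewrite gt_eqF// addr_gt0.
have Eb : (b i * - coords x i 0 + a i * - coords x i 0) / (b i + a i) = - coords x i 0.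
  by field; rewrite gt_eqF// addr_gt0.
rewrite Ea Eb; ring.
Qed.

Lemma coords_backward x v h i :
  coords (x - h *: v) i 0 = coords x i 0 - h * (P^T *m v) i 0.
Proof.
by rewrite /coords mulmxBr -scalemxAr !mxE addrAC.
Qed.

Definition running_cost (x : X) : R := \sum_i coords x i 0 ^+ 2 / 2.

Lemma continuous_running_cost : continuous running_cost.
Proof.
move=> x; apply: (@cvgr_sum _ _ _ (nbhs x)) => i.
apply: cvgM; last exact: cvg_cst.
have ci : continuous (fun x : X => x i 0) by exact: coord_continuous.
have cc := comp_cts continuous_coords ci.
by rewrite expr2; under eq_fun do rewrite expr2; apply: cvgM; exact: cc.
Qed.

(** A point w optimal for the earlier point p - h (v, 1) can still be reached
    from p. *)
Lemma value_dynamic_le p v : 0 < p.2 -> extreme_velocity P a b v ->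
  exists C, \forall h \near 0^'+,
    W p <= W (p - h *: ((v, 1) : X * R)) + h * running_cost p.1 + C * h ^+ 2.
Proof.
case: p => x t /= t0 vV.
exists (\sum_i (`|coords x i 0| + `|(P^T *m v) i 0|) * `|(P^T *m v) i 0|).
have m0 : 0 < Num.min 1 t by rewrite lt_min ltr01.
apply: filterS (near0_right_le m0) => h /andP[h0]; rewrite le_min => /andP[h1 ht].
have th0 : 0 <= t - h by rewrite subr_ge0.
have -> : (x, t) - h *: ((v, 1) : X * R) = (x - h *: v, t - h).
  by congr (_, _); congr (_ - _); exact: mulr1.
have [w r ->] := value_attained (x - h *: v) th0.
have r' : reachable x t w.
  move=> i; have := r i; rewrite coords_backward.
  exact: reach1_forward.
apply: le_trans (value_le r' (ltW t0)) _.
rewrite /total_cost -[leRHS]addrA [leRHS]addrAC lerD2r.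
rewrite mulr_sumr mulr_suml -!big_split; apply: ler_sum => i _ /=.
rewrite addrA coords_backward; have h01 : 0 <= h <= 1 by rewrite h0.
exact: (cost1_dynamic_le (a_gt0 i) (b_gt0 i) (vV i) h01 (r' i)).
Qed.

(** A point w optimal at p provides an extreme speed in each coordinate, and w
    remains reachable from p - h (v, 1). *)
Lemma value_dynamic_ge p : 0 < p.2 ->
  exists2 v, extreme_velocity P a b v & exists C, \forall h \near 0^'+,
    W (p - h *: ((v, 1) : X * R)) + h * running_cost p.1 <= W p + C * h ^+ 2.
Proof.
case: p => x t /= t0.
have [w r WE] := value_attained x (ltW t0).
have /choice[vC HvC] i : exists vC : R * R, extreme_speed (a i) (b i) vC.1 /\
    \forall h \near (0 : R)^'+,
      reach1 (coords x i 0 - h * vC.1) (t - h) (w i 0) (a i) (b i) /\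
      cost1 (coords x i 0 - h * vC.1) (t - h) (w i 0) (a i) (b i)
        + h * (coords x i 0 ^+ 2 / 2)
        <= cost1 (coords x i 0) t (w i 0) (a i) (b i) + vC.2 * h ^+ 2.
  have [v ev [C HC]] := cost1_dynamic_ge (a_gt0 i) (b_gt0 i) t0 (r i).
  by exists (v, C).
have PT_unit : P^T \in unitmx by rewrite unitmx_tr.
pose v := invmx P^T *m \col_i (vC i).1.
have vE i : (P^T *m v) i 0 = (vC i).1 by rewrite mulKVmx// mxE.
exists v; first by move=> i; rewrite vE; have [] := HvC i.
exists (\sum_i (vC i).2).
have FF : Filter ((0 : R)^'+) by exact: at_right_proper_filter.
have := @filter_forall _ _ _ _ FF (fun i => (HvC i).2).
have h01 : \forall h \near (0 : R)^'+, 0 <= h <= t by exact: near0_right_le.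
apply: filterS2 h01 => h /andP[h0 ht] Hh.
have th0 : 0 <= t - h by rewrite subr_ge0.
have -> : (x, t) - h *: ((v, 1) : X * R) = (x - h *: v, t - h).
  by congr (_, _); congr (_ - _); exact: mulr1.
have r' : reachable (x - h *: v) (t - h) w.
  by move=> i; rewrite coords_backward vE; have [] := Hh i.
rewrite WE; apply: (@le_trans _ _
  (total_cost (x - h *: v) (t - h) w + h * running_cost x)).
  by rewrite lerD2r; exact: value_le.
rewrite /total_cost [leLHS]addrAC [leRHS]addrAC lerD2r.
rewrite mulr_sumr mulr_suml -!big_split; apply: ler_sum => i _ /=.
by rewrite coords_backward vE; have [] := Hh i.
Qed.

End ValueFunction.

(** * Extension to negative times *)

Section HalfSpace.
Context {R : realType} {n : nat}.
Local Notation X := 'cV[R]_n.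

(** Extending functions on the closed half-space constantly to negative times
    turns continuity within the half-space into continuity. *)
Definition clamp_time (W : X * R -> R) (p : X * R) : R := W (p.1, Num.max p.2 0).

Lemma clamp_timeE W p : 0 <= p.2 -> clamp_time W p = W p.
Proof. by move=> p0; rewrite /clamp_time max_l// -surjective_pairing. Qed.

Lemma continuous_clamp_time W : cont_halfspace W -> continuous (clamp_time W).
Proof.
move=> /subspace_continuousP cW p.
have cclamp : (fun q : X * R => (q.1, Num.max q.2 0)) @ p --> (p.1, Num.max p.2 0).
  apply: (@cvg_pair _ _ _ (nbhs p) (nbhs p.1) (nbhs (Num.max p.2 0))).
    exact: cvg_fst.
  have H := @continuous_max _ (X * R)%type snd (fun=> 0 : R) p.
  by apply: H; [exact: cvg_snd|exact: cvg_cst].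
have m0 (q : X * R) : 0 <= Num.max q.2 0 by rewrite le_max lexx orbT.
apply: cvg_comp (cW (p.1, Num.max p.2 0) (m0 p)).
move=> A /cclamp nA.
have {}nA : nbhs p [set q : X * R |
  0 <= Num.max q.2 0 -> A (q.1, Num.max q.2 0)] by exact: nA.
by apply: filterS nA => q /(_ (m0 q)).
Qed.

Lemma cont_halfspace_clamp_time W : continuous (clamp_time W) -> cont_halfspace W.
Proof.
move=> cW; apply/subspace_continuousP => p p0.
have Weq : \forall q \near within [set q : X * R | 0 <= q.2] (nbhs p),
    clamp_time W q = W q.
  by apply: filterS (withinT _ (nbhs_filter p)) => q q0; exact: clamp_timeE.
have := @cvg_within_filter _ _ (clamp_time W) (nbhs p) _ _
  [set q : X * R | 0 <= q.2] (cW p).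
rewrite clamp_timeE// => cWp.
by move=> t /cWp; exact: (near_eq_cvg Weq).
Qed.

Lemma near_time_gt0 (p : X * R) : 0 < p.2 -> \forall q \near p, 0 < q.2.
Proof.
have c2 : (fun q : X * R => q.2) @ p --> p.2 by exact: cvg_snd.
exact: cvgr_gt c2 _.
Qed.

Lemma viscosity_subsolution_eq (H : X -> X -> R) W W' :
  (forall p, 0 < p.2 -> W p = W' p) ->
  viscosity_subsolution H W -> viscosity_subsolution H W'.
Proof.
move=> WW' sub phi phiC p p0 pmax; have near0 := near_time_gt0 p0.
apply: sub phiC _ (p0) _.
by apply: filterS2 near0 pmax => q q0; rewrite (WW' q q0) (WW' p p0).
Qed.

Lemma viscosity_supersolution_eq (H : X -> X -> R) W W' :
  (forall p, 0 < p.2 -> W p = W' p) ->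
  viscosity_supersolution H W -> viscosity_supersolution H W'.
Proof.
move=> WW' sup phi phiC p p0 pmax; have near0 := near_time_gt0 p0.
apply: sup phiC _ (p0) _.
by apply: filterS2 near0 pmax => q q0; rewrite (WW' q q0) (WW' p p0).
Qed.

End HalfSpace.

(** * Existence and uniqueness *)

Theorem proposition6 (R : realType) (n : nat)
  (Phi : 'cV[R]_n -> R) (v0 : 'cV[R]_n) (K : 'cV[R]_n -> R)
  (u : 'I_n -> 'cV[R]_n) (a b : 'I_n -> R)
  (Phi_cont : continuous Phi)
  (K_ge0 : forall x, 0 <= K x)
  (K_pa : piecewise_affine K)
  (K_hom : homogeneous1 K)
  (K_convex : convex_function [set: 'cV[R]_n] K)
  (u_free : free [seq u j | j : 'I_n])
  (a_gt0 : forall i, 0 < a i)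
  (b_gt0 : forall i, 0 < b i)
  (K_ball : [set x | K x <= 1] =
     conv_hull (\bigcup_j [set (1 / a j) *: u j; - ((1 / b j) *: u j)])) :
  let P : 'M[R]_n := \matrix_(i < n, j < n) u j i 0 in
  let M : 'M[R]_n := P *m P^T in
  let V : 'cV[R]_n * R -> R := value P a b v0 Phi in
  let H (x p : 'cV[R]_n) : R := K p - 2^-1 * mnorm M (x - v0) ^+ 2 in
  [/\ forall x t, 0 <= t -> valueE P a b v0 Phi x t = (V (x, t))%:E,
      cont_halfspace V,
      viscosity_solution H Phi V &
      forall W : 'cV[R]_n * R -> R,
        cont_halfspace W -> viscosity_solution H Phi W ->
        forall x t, 0 <= t -> W (x, t) = V (x, t)].
Proof.
move=> P M V H.
have P_unit : P \in unitmx by exact: columns_unitmx.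
have KE : K =1 support_fun P a b by exact: (gauge_unique a_gt0 b_gt0).
have HE : H = fun x p => support_fun P a b p - running_cost P v0 x.
  apply/funext => x; apply/funext => p; rewrite /H KE; congr (_ - _).
  rewrite /mnorm /M -mulmxA inner_mulmx sqr_sqrtr; last first.
    by apply: sumr_ge0 => i _; rewrite -expr2 sqr_ge0.
  rewrite /inner mulr_sumr; apply: eq_bigr => i _.
  by rewrite /coords -mulmxBr -expr2 mulrC.
have V_sub : viscosity_subsolution H V.
  rewrite HE; apply: (@viscosity_subsolution_dynamic _ _ (extreme_velocity P a b)).
    by move=> g; exact: extreme_velocity_attained.
  by move=> p v; exact: value_dynamic_le.
have V_sup : viscosity_supersolution H V.
  rewrite HE; apply: (@viscosity_supersolution_dynamic _ _ (extreme_velocity P a b)).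
    by move=> v g; exact: extreme_velocity_le.
  by move=> p; exact: value_dynamic_ge.
have V_init x : V (x, 0) = Phi x by exact: value_initial.
have V_cont : continuous (clamp_time V) by exact: continuous_value.
split=> //; first by move=> x t; exact: valueE_fine.
  exact: cont_halfspace_clamp_time.
have K_sub : sublinear (support_fun P a b).
  split=> [p q|c p c0]; first exact: support_funD.
  by rewrite support_funZ// ltW.
have cmp W1 W2 : continuous (clamp_time W1) -> continuous (clamp_time W2) ->
    viscosity_subsolution H W1 -> viscosity_supersolution H W2 ->
    (forall x, W1 (x, 0) = W2 (x, 0)) ->
    forall x t, 0 <= t -> W1 (x, t) <= W2 (x, t).
  move=> c1 c2 sub sup init x t t0.
  rewrite -[W1 _]clamp_timeE// -[W2 _]clamp_timeE//.
  have eq_clamp (W : 'cV[R]_n * R -> R) (p : 'cV[R]_n * R) :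
      0 < p.2 -> W p = clamp_time W p.
    by move=> p0; rewrite clamp_timeE// ltW.
  move: sub sup => /(viscosity_subsolution_eq (@eq_clamp W1)) sub.
  move=> /(viscosity_supersolution_eq (@eq_clamp W2)) sup.
  rewrite HE in sub sup.
  have f_cont := continuous_running_cost (P := P) (v0 := v0).
  have := comparison K_sub (support_lip_ge0 P a_gt0 b_gt0)
    (support_fun_bound P a_gt0 b_gt0) f_cont c1 c2 sub sup.
  by apply=> // z; rewrite !clamp_timeE//= init.
move=> W W_cont [W_sub W_sup W_init] x t t0.
have cW := continuous_clamp_time W_cont.
apply/eqP; rewrite eq_le; apply/andP; split; apply: cmp => // z;
  by rewrite W_init V_init.
Qed.
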